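(* For a positive integer $n$, let $X_n$ denote the total height of a rooted labeled tree chosen uniformly at random among all $n^{n-1}$ rooted labeled trees on the vertex set $\{1,\dots,n\}$, and let $$W_n := \frac{n!}{n^{n-1}}\sum_{k=0}^{n-2}\frac{n^k}{k!}.$$ Then the third moment about the mean satisfies $$\mathbb{E}\big[(X_n-\mathbb{E}X_n)^3\big] = 2W_n^3 + \frac{17}{2}\, n W_n^2 + \left(-\frac{25}{8}n^3 + \frac{277}{24}n^2 - \frac{1}{60}n\right) W_n - \frac{151}{30}n^4 + \frac{76}{15}n^3 - \frac{1}{30}n^2,$$ and, as $n\to\infty$, $$\mathbb{E}\big[(X_n-\mathbb{E}X_n)^3\big] \sim \left(\frac{1}{2}\sqrt{2}\,\pi^{3/2} - \frac{25}{16}\sqrt{2}\sqrt{\pi}\right) n^{9/2}.$$ Consequently the skewness $\mathbb{E}[(X_n-\mathbb{E}X_n)^3]/\operatorname{Var}(X_n)^{3/2}$ tends, as $n\to\infty$, to $$\frac{\left(6\pi - \frac{75}{4}\right)\sqrt{3}\sqrt{\frac{\pi}{10-3\pi}}}{10-3\pi} = 0.7005665208\dots$$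
   Context: A rooted labeled tree on $n$ vertices is a tree on the vertex set $\{1,\dots,n\}$ together with a distinguished vertex, the root. The height of a vertex is its graph distance to the root. The total height of a rooted labeled tree is the sum of the heights of all its vertices. All expectations and variances are taken with respect to the uniform distribution on the set of $n^{n-1}$ rooted labeled trees on $\{1,\dots,n\}$. The notation $a_n\sim b_n$ means $a_n/b_n\to 1$.
   Formalization: The printed decimal value 0.7005665208... of the limiting skewness is numerically wrong: the closed form equals 0.70056652935..., so the formal statement asserts the digits 0.7005665293... instead. *)

(* Defs.v *)
From HB Require Import structures.
From mathcomp Require Import all_boot all_order all_algebra.
From mathcomp Require Import all_classical all_reals all_analysis.

Set Implicit Arguments.
Unset Strict Implicit.
Unset Printing Implicit Defensive.

Import Order.TTheory GRing.Theory Num.Theory.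
Import numFieldNormedType.Exports.

Section Trees.
Context {V : finType}.
Implicit Types (E : {set {set V}}) (u v : V).

(* A simple graph on V is given by its set of edges, which are two-element
   subsets of V. *)
Definition simple_graph E : Prop := forall e, e \in E -> #|e| = 2.

Definition adj E : rel V := fun u v => [set u; v] \in E.

Definition connected_graph E : Prop := forall u v, connect (adj E) u v.

(* [:: u; v] is a ucycle as soon as u and v are adjacent, so the cycles in the
   sense of graph theory are the ucycles with at least three vertices. *)
Definition acyclic_graph E : Prop :=
  forall c : seq V, ucycle (adj E) c -> size c <= 2.

Definition is_tree E : Prop :=
  [/\ simple_graph E, connected_graph E & acyclic_graph E].

Definition has_walk E u v (d : nat) : bool :=
  [exists p : d.-tuple V, path (adj E) u p && (last u p == v)].

(* The least d such that there is a walk with d edges from u to v. A shortest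
   walk has fewer than #|V| edges; the value is #|V| if there is no walk. *)
Definition graph_dist E u v : nat := find (has_walk E u v) (iota 0 #|V|).

End Trees.

(* The vertex set {1, ..., n} is represented by 'I_n = {0, ..., n-1}; a rooted
   labeled tree is the pair of its edge set and its root. *)
Definition rooted_graph (n : nat) : finType := ({set {set 'I_n}} * 'I_n)%type.

Definition rooted_trees (n : nat) : {set rooted_graph n} :=
  [set t : rooted_graph n | `[< is_tree t.1 >]].

Definition height (n : nat) (t : rooted_graph n) (v : 'I_n) : nat :=
  graph_dist t.1 v t.2.

Definition total_height (n : nat) (t : rooted_graph n) : nat :=
  \sum_(v < n) height t v.

Local Open Scope ring_scope.

Section Moments.
Variable R : realType.

Definition unif_mean (T : finType) (A : {set T}) (f : T -> R) : R :=
  (\sum_(x in A) f x) / #|A|%:R.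

Definition central_moment (T : finType) (A : {set T}) (f : T -> R) (k : nat) :=
  unif_mean A (fun x => (f x - unif_mean A f) ^+ k).

Definition X (n : nat) (t : rooted_graph n) : R := (total_height t)%:R.

Definition third_moment (n : nat) : R :=
  central_moment (rooted_trees n) (@X n) 3.

Definition variance_X (n : nat) : R :=
  central_moment (rooted_trees n) (@X n) 2.

Definition skewness (n : nat) : R :=
  third_moment n / variance_X n `^ (3 / 2).

Definition W (n : nat) : R :=
  n`!%:R / n%:R ^+ n.-1 * \sum_(0 <= k < n.-1) n%:R ^+ k / k`!%:R.

(* x = 0.d_1 d_2 ... d_k ... for the list ds = [:: d_1; ...; d_k], with the
   digits truncated and not rounded. *)
Definition decimal_digits (x : R) (ds : seq nat) : Prop :=
  let a := \sum_(i < size ds) (nth 0%N ds i)%:R / 10 ^+ i.+1 in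
  a <= x < a + 10 ^- size ds.

End Moments.

(* Main.v *)
(* Peeling off the roots of a forest with root set R and N further vertices,
   the children J of the roots become the new roots, each of the N vertices
   loses one level, and there are |R|^|J| ways to attach J to R. Hence the sum
   of the i-th powers of the total height is a number e_i(N, k), k = |R|, with
     e_i(N, k) = sum_j C(N, j) k^j sum_l C(i, l) N^(i-l) e_l(N - j, j).
   With H_i = sum_a k^_a h_{i,a}(u), where k^_a is the falling factorial, and
     e_i(N, k) = N! [u^N] e^((N+k) u) H_i(u, k),
   the sum over j turns e^(N u) into e^((N+k) u) and k^_a into (k u)^a, while
   multiplication by N is u d/du, so that the recursion becomes an identity
   between rational functions of u with denominators powers of 1 - u. For
   k = 1 the coefficients of e^(n u) (1-u)^(-m) reduce to two of them, whose
   quotient is n + W_n.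
   For the limits, W_n = n sum_{j >= 2} prod_{i < j} (1 - i/n), a Riemann sum of
   the Gauss integral, so that W_n ~ sqrt (pi/2) n^(3/2). *)
Require Import Defs.
From HB Require Import structures.
From mathcomp Require Import all_boot all_order all_algebra.
From mathcomp Require Import ring lra zify.
From mathcomp Require Import boolp.

Set Implicit Arguments.
Unset Strict Implicit.
Unset Printing Implicit Defensive.

Import Order.TTheory GRing.Theory Num.Theory.

(** * Exponential generating functions *)

Local Open Scope ring_scope.

Section Egf.
Variable R : realFieldType.
Implicit Types (f g : nat -> R) (x y : R) (a m N k : nat).

(* Coefficients of u F, of e^(x u) F and of e^(x u) (1-u)^(1-m), where f are the
   coefficients of F. *)
Definition delay f N : R := if N is N'.+1 then f N' else 0.

Definition expconv x f N : R := \sum_(j < N.+1) x ^+ j / j`!%:R * f (N - j)%N.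

Fixpoint expgeo m x N : R :=
  if m is m'.+1 then \sum_(i < N.+1) expgeo m' x i
  else x ^+ N / N`!%:R - delay (fun i => x ^+ i / i`!%:R) N.

Lemma expgeoS m x N : expgeo m.+1 x N = \sum_(i < N.+1) expgeo m x i.
Proof. by []. Qed.

Lemma expgeo0E x N : expgeo 0 x N =
  x ^+ N / N`!%:R - delay (fun i => x ^+ i / i`!%:R) N.
Proof. by []. Qed.

Arguments expgeo : simpl never.

Lemma fact_neq0 N : N`!%:R != 0 :> R.
Proof. by rewrite pnatr_eq0 -lt0n fact_gt0. Qed.

Lemma expgeo0 m x : expgeo m x 0 = 1.
Proof.
elim: m => [|m IH]; first by rewrite expgeo0E fact0 expr0 divr1 subr0.
by rewrite expgeoS big_ord1.
Qed.

Lemma expgeo1 x N : expgeo 1 x N = x ^+ N / N`!%:R.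
Proof.
elim: N => [|N IH]; first by rewrite expgeo0 fact0 expr0 divr1.
by rewrite expgeoS big_ord_recr /= -expgeoS IH expgeo0E subrKC.
Qed.

(** Since u = 1 - (1-u), a factor u becomes a difference in m; the factor u^a likewise becomes the
    a-th difference in the next lemmas. *)
Lemma delay_expgeo m x N :
  delay (expgeo m.+1 x) N = expgeo m.+1 x N - expgeo m x N.
Proof.
case: N => [|N]; first by rewrite !expgeo0 subrr.
by rewrite [in RHS]expgeoS big_ord_recr /= -expgeoS addrK.
Qed.

Lemma eq_iter_delay a f g : f =1 g -> iter a delay f =1 iter a delay g.
Proof. by move=> fg; elim: a => [|a IH] [|N] //=. Qed.

Lemma iter_delay_expgeo2 m x N (d := fun m => expgeo m.+1 x N - expgeo m x N) :
  iter 2 delay (expgeo m.+2 x) N = d m.+1 - d m.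
Proof.
rewrite /d {d}; case: N => [|N] /=; first by rewrite !expgeo0 !subrr.
by rewrite delay_expgeo -!delay_expgeo /=.
Qed.

Lemma iter_delay_expgeo3 m x N (d := fun m => expgeo m.+1 x N - expgeo m x N)
    (d2 := fun m => d m.+1 - d m) :
  iter 3 delay (expgeo m.+3 x) N = d2 m.+1 - d2 m.
Proof.
rewrite /d2 /d {d2 d}; case: N => [|N]; first by rewrite !expgeo0 !subrr.
by rewrite iterS [LHS]iter_delay_expgeo2 -!delay_expgeo.
Qed.

(** Coefficients of u F' = x u F + (m-1) u F / (1-u) for F = e^(x u) (1-u)^(1-m). *)
Lemma expgeo_deriv m x N :
  N%:R * expgeo m x N =
  x * delay (expgeo m x) N + (m%:R - 1) * delay (expgeo m.+1 x) N.
Proof.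
elim: m N => [|m IHm] N.
  case: N => [|N]; first by rewrite !mul0r !mulr0 addr0.
  have E n : n.+1%:R * (x ^+ n.+1 / n.+1`!%:R) = x * (x ^+ n / n`!%:R) :> R.
    rewrite factS natrM exprS; field.
    by rewrite fact_neq0 nat1r pnatr_eq0.
  have -> : delay (expgeo 1 x) N.+1 = x ^+ N / N`!%:R := expgeo1 x N.
  rewrite /= !expgeo0E mulrBr E /=.
  case: N => [|N] /=; first by rewrite fact0 expr0; ring.
  by rewrite mulrBr -[x * (x ^+ N / _)]E -[N.+2%:R]natr1; ring.
elim: N => [|N IHN]; first by rewrite /= mul0r !mulr0 addr0.
have D : expgeo m.+1 x N.+1 = expgeo m.+1 x N + expgeo m x N.+1.
  by rewrite expgeoS big_ord_recr.
have D2 := delay_expgeo m x N; have D3 := delay_expgeo m.+1 x N.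
have /= H := IHm N.+1; rewrite /=.
rewrite D mulrDr H.
rewrite -natr1 mulrDl IHN mul1r D2 D3 /= -(natr1 m).
ring.
Qed.

(** With x = N + k, the term N c_(m+1) cancels from [expgeo_deriv] at m + 1. What remains trades a
    factor N for higher indices m. *)
Lemma expgeo_size m N k (x := (N + k)%:R) :
  N%:R * expgeo m x N = k%:R * (expgeo m.+1 x N - expgeo m x N)
    + m%:R * (expgeo m.+2 x N - expgeo m.+1 x N).
Proof.
have := expgeo_deriv m.+1 x N.
rewrite !delay_expgeo -natr1 addrK {2}/x natrD => H.
apply: (addrI (N%:R * (expgeo m.+1 x N - expgeo m x N))).
rewrite addrA -mulrDl -H; ring.
Qed.

(** The factors e^(x u) and 1/(1-u) commute. *)
Lemma expconv_sum x f N :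
  expconv x (fun i => \sum_(l < i.+1) f l) N = \sum_(i < N.+1) expconv x f i.
Proof.
elim: N => [|N IH]; first by rewrite /expconv !big_ord1.
rewrite [RHS]big_ord_recr /= -IH /expconv.
rewrite big_ord_recr [X in _ = _ + X]big_ord_recr /= subnn big_ord1 addrA.
congr (_ + _); rewrite -big_split /=; apply: eq_bigr => -[j /= jN] _.
by rewrite subSn // big_ord_recr /= mulrDr.
Qed.

Lemma expconvB x f g N :
  expconv x (fun i => f i - g i) N = expconv x f N - expconv x g N.
Proof.
by rewrite /expconv -sumrB; apply: eq_bigr => j _; rewrite mulrBr.
Qed.

Lemma expconv_delay x f N : expconv x (delay f) N = delay (expconv x f) N.
Proof.
case: N => [|N]; first by rewrite /expconv big_ord1 /= mulr0.
rewrite /expconv big_ord_recr /= subnn mulr0 addr0.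
by apply: eq_bigr => -[j /= jN] _; rewrite subSn.
Qed.

Lemma eq_expconv x f g N : f =1 g -> expconv x f N = expconv x g N.
Proof. by move=> fg; apply: eq_bigr => j _; rewrite fg. Qed.

(** Since e^(y u) e^(x u) = e^((x+y) u), which is the binomial theorem [E1] on coefficients. *)
Lemma expconv_expgeo m x y N :
  expconv y (expgeo m x) N = expgeo m (x + y) N.
Proof.
have E1 n : expconv y (fun i => x ^+ i / i`!%:R) n = (x + y) ^+ n / n`!%:R.
  rewrite exprDn big_distrl /=; apply: eq_bigr => -[j /= jn] _.
  rewrite -mulr_natr -(bin_fact (n := n) (m := j)) //.
  rewrite !natrM; field.
  by rewrite !fact_neq0 pnatr_eq0 -lt0n bin_gt0.
elim: m N => [|m IH] N; last first.
  rewrite expgeoS (eq_expconv _ _ (expgeoS _ _)) expconv_sum.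
  by apply: eq_bigr => i _; rewrite IH.
rewrite (eq_expconv _ _ (expgeo0E _)) expconvB E1 expgeo0E; congr (_ - _).
by rewrite expconv_delay; case: N => //= N.
Qed.

(** As j^_a / j! = 1 / (j-a)! for j >= a, the weight j^_a turns e^(x u) into (x u)^a e^(x u). *)
Lemma expconv_ffact a x f N :
  \sum_(j < N.+1) (j ^_ a)%:R * (x ^+ j / j`!%:R * f (N - j)%N)
  = x ^+ a * iter a delay (expconv x f) N.
Proof.
elim: a N => [|a IH] N.
  rewrite expr0 mul1r; apply: eq_bigr => j _.
  by rewrite ffactn0 mul1r.
rewrite big_ord_recl ffact0n mul0r add0r.
case: N => [|N]; first by rewrite big_ord0 /= mulr0.
rewrite exprS -mulrA /= -IH big_distrr /=.
apply: eq_bigr => -[j /= jN] _.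
rewrite /bump /= add1n subSS ffactSS factS exprS !natrM; field.
by rewrite fact_neq0 nat1r pnatr_eq0.
Qed.

(* The rational functions H_0, ..., H_3 of the header comment, as combinations
   of the coefficients c m of e^((N+k) u) (1-u)^(1-m) and the falling factorials
   p1, p2, p3 of k. They come from differentiating F(x, t) = x exp F(x e^t, t)
   in t at t = 0, where F(x, 0) is the tree function. *)
Definition moment_form (i : nat) (p1 p2 p3 : R) (c : nat -> R) : R :=
  match i with
  | 0 => c 0%N
  | 1 => p1 * (c 2%N - c 1%N)
  | 2 => p1 * (4 * c 3%N - 9 * c 4%N + 5 * c 5%N)
         + p2 * (c 2%N - 2 * c 3%N + c 4%N)
  | _ => p1 * (16 * c 4%N - 116 * c 5%N + 273 * c 6%N - 263 * c 7%N
               + 90 * c 8%N)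
         + p2 * (- 12 * c 4%N + 39 * c 5%N - 42 * c 6%N + 15 * c 7%N)
         + p3 * (- c 3%N + 3 * c 4%N - 3 * c 5%N + c 6%N)
  end.

(** * The closed form of e_i(N, k) and its recursion *)

Definition forest_moment i N k : R :=
  N`!%:R * moment_form i (k ^_ 1)%:R (k ^_ 2)%:R (k ^_ 3)%:R
             (fun m => expgeo m (N + k)%:R N).

(** [Phi l] is what [moment_form l] becomes after the sum over j: a falling factorial p_a times c_m
    has turned into k^a times the a-th difference at m - a. Eliminating N by the relation of
    [expgeo_size] leaves an identity that is linear in the c_m, with polynomials in k as
    coefficients. *)
Lemma moment_form_rec i (N k : R) (c : nat -> R)
    (p1 := k) (p2 := k * (k - 1)) (p3 := k * (k - 1) * (k - 2))
    (d := fun m => c m.+1 - c m) (d2 := fun m => d m.+1 - d m)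
    (d3 := fun m => d2 m.+1 - d2 m)
    (Phi := fun l => match l with
      | 0 => c 0%N
      | 1 => k * (d 1%N - d 0%N)
      | 2 => k * (4 * d 2%N - 9 * d 3%N + 5 * d 4%N)
             + k ^+ 2 * (d2 0%N - 2 * d2 1%N + d2 2%N)
      | _ => k * (16 * d 3%N - 116 * d 4%N + 273 * d 5%N - 263 * d 6%N
                  + 90 * d 7%N)
             + k ^+ 2 * (- 12 * d2 2%N + 39 * d2 3%N - 42 * d2 4%N
                         + 15 * d2 5%N)
             + k ^+ 3 * (- d3 0%N + 3 * d3 1%N - 3 * d3 2%N + d3 3%N)
      end) :
  (i <= 3)%N ->
  (forall m, N * c m = k * (c m.+1 - c m) + m%:R * (c m.+2 - c m.+1)) ->
  moment_form i p1 p2 p3 c = \sum_(l < i.+1) 'C(i, l)%:R * N ^+ (i - l) * Phi l.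
Proof.
move=> i3 r.
have rr m : N * (N * c m) =
    k * (N * c m.+1 - N * c m) + m%:R * (N * c m.+2 - N * c m.+1).
  by rewrite [in LHS]r; ring.
have rrr m : N * (N * (N * c m)) =
    k * (N * (N * c m.+1) - N * (N * c m))
    + m%:R * (N * (N * c m.+2) - N * (N * c m.+1)).
  by rewrite [in LHS]r; ring.
rewrite /p1 /p2 /p3.
case: i i3 => [|[|[|[|//]]]] _; rewrite !big_ord_recr big_ord0 /= /d3 /d2 /d.
- by rewrite bin0 expr0; ring.
- rewrite bin0 bin1.
  transitivity (N * c 0%N + k * (c 2%N - c 1%N - (c 1%N - c 0%N))); last by
      ring.
  by rewrite r; ring.
- rewrite !bin0 !bin1 ?binn.
  (* The powers of N are nested into the shape that [r], [rr] and [rrr] rewrite. *)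
  transitivity (N * (N * c 0%N)
     + 2 * k * (N * c 2%N - 2 * (N * c 1%N) + N * c 0%N)
     + (k * (4 * (c 3%N - c 2%N) - 9 * (c 4%N - c 3%N) + 5 * (c 5%N - c 4%N))
       + k ^+ 2 * ((c 2%N - 2 * c 1%N + c 0%N) - 2 * (c 3%N - 2 * c 2%N + c 1%N)
                   + (c 4%N - 2 * c 3%N + c 2%N))));  last by ring.
  by rewrite rr !r; ring.
have -> : 'C(3, 2) = 3 by [].
rewrite !bin0 !bin1 ?binn.
transitivity (N * (N * (N * c 0%N))
   + 3 * k * (N * (N * c 2%N) - 2 * (N * (N * c 1%N)) + N * (N * c 0%N))
   + 3 * (k * (4 * (N * c 3%N - N * c 2%N) - 9 * (N * c 4%N - N * c 3%N)
               + 5 * (N * c 5%N - N * c 4%N))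
       + k ^+ 2 * ((N * c 2%N - 2 * (N * c 1%N) + N * c 0%N)
                   - 2 * (N * c 3%N - 2 * (N * c 2%N) + N * c 1%N)
                   + (N * c 4%N - 2 * (N * c 3%N) + N * c 2%N)))
   + (k * (16 * (c 4%N - c 3%N) - 116 * (c 5%N - c 4%N) + 273 * (c 6%N - c 5%N)
           - 263 * (c 7%N - c 6%N) + 90 * (c 8%N - c 7%N))
      + k ^+ 2 * (- 12 * (c 4%N - 2 * c 3%N + c 2%N)
                   + 39 * (c 5%N - 2 * c 4%N + c 3%N)
                  - 42 * (c 6%N - 2 * c 5%N + c 4%N)
                   + 15 * (c 7%N - 2 * c 6%N + c 5%N))
      + k ^+ 3 * (- (c 3%N - 3 * c 2%N + 3 * c 1%N - c 0%N)
                  + 3 * (c 4%N - 3 * c 3%N + 3 * c 2%N - c 1%N)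
                  - 3 * (c 5%N - 3 * c 4%N + 3 * c 3%N - c 2%N)
                  + (c 6%N - 3 * c 5%N + 3 * c 4%N - c 3%N)))); last by ring.
by rewrite rrr !rr !r; ring.
Qed.

Lemma forest_moment_rec i N k : (i <= 3)%N ->
  forest_moment i N k =
  \sum_(j < N.+1) 'C(N, j)%:R * k%:R ^+ j *
    \sum_(l < i.+1) 'C(i, l)%:R * N%:R ^+ (i - l) * forest_moment l (N - j) j.
Proof.
move=> i3.
(* The contribution of p_a c_m. A forest with j roots and N - j other vertices has N vertices, so
   the exponential is e^(N u) for every j. *)
pose t a m j : R :=
  (j ^_ a)%:R * (k%:R ^+ j / j`!%:R * expgeo m N%:R (N - j)).
pose c m := expgeo m (N + k)%:R N.
pose d m := c m.+1 - c m.
pose d2 m := d m.+1 - d m; pose d3 m := d2 m.+1 - d2 m.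
have A a m : \sum_(j < N.+1) t a m j =
    k%:R ^+ a * iter a delay (expgeo m (N + k)%:R) N.
  rewrite expconv_ffact; congr (_ * _).
  have : expconv k%:R (expgeo m N%:R) =1 expgeo m (N + k)%:R.
    by move=> n; rewrite expconv_expgeo natrD.
  by move=> /eq_iter_delay ->.
have A0 m : \sum_(j < N.+1) t 0%N m j = c m by rewrite A expr0 mul1r.
have A1 m : \sum_(j < N.+1) t 1%N m.+1 j = k%:R * d m.
  by rewrite A /= delay_expgeo expr1.
have A2 m : \sum_(j < N.+1) t 2%N m.+2 j = k%:R ^+ 2 * d2 m.
  by rewrite A iter_delay_expgeo2.
have A3 m : \sum_(j < N.+1) t 3%N m.+3 j = k%:R ^+ 3 * d3 m.
  by rewrite A iter_delay_expgeo3.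
(* For k < a the subtraction in nat is truncated, but then k^_a = 0. *)
have ffactE a : (k ^_ a.+1)%:R = (k ^_ a)%:R * (k%:R - a%:R) :> R.
  rewrite ffactnSr natrM; case: (leqP a k) => [ak|ka]; first by rewrite natrB.
  by rewrite ffact_small // !mul0r.
rewrite [LHS]/forest_moment !ffactE ffactn0 subr0 !mul1r.
rewrite (@moment_form_rec i N%:R k%:R c i3 (fun m => expgeo_size m N k)).
transitivity (\sum_(l < i.+1) 'C(i, l)%:R * N%:R ^+ (i - l) *
    \sum_(j < N.+1) 'C(N, j)%:R * k%:R ^+ j * forest_moment l (N - j) j);
  last first.
  rewrite [RHS](eq_bigr _ (fun _ _ => mulr_sumr _ _ _ _)) exchange_big /=.
  apply: eq_bigr => l _; rewrite mulr_sumr; apply: eq_bigr => j _.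
  by ring.
rewrite mulr_sumr; apply: eq_bigr => -[l /= li] _.
rewrite mulrCA -!mulrA; congr (_ * (_ * _)).
(* Here C(N, j) (N-j)! = N! / j!. *)
transitivity (\sum_(j < N.+1) N`!%:R * (k%:R ^+ j / j`!%:R *
    moment_form l (j ^_ 1)%:R (j ^_ 2)%:R (j ^_ 3)%:R
      (fun m => expgeo m N%:R (N - j)))); last first.
  apply: eq_bigr => -[j /= jN] _; rewrite /forest_moment subnK //.
  rewrite -(bin_fact (n := N) (m := j)) // !natrM; field.
  by rewrite fact_neq0.
rewrite -mulr_sumr; congr (_ * _); symmetry.
have {li i3} : (l <= 3)%N by rewrite (leq_trans _ i3).
case: l => [|[|[|[|//]]]] _.
- transitivity (\sum_(j < N.+1) (t 0%N 0%N j)).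
    by apply: eq_bigr => j _; rewrite /t /moment_form ?ffactn0; ring.
  by rewrite A0.
- transitivity (\sum_(j < N.+1) (t 1%N 2%N j - t 1%N 1%N j)).
    by apply: eq_bigr => j _; rewrite /t /moment_form ?ffactn0; ring.
  rewrite ?(big_split, sumrN) /= -?mulr_sumr !(A0, A1, A2, A3).
  rewrite /d3 /d2 /d; ring.
- transitivity (\sum_(j < N.+1) (4 * t 1%N 3%N j - 9 * t 1%N 4%N j + 5 * t 1%N
      5%N j + t 2%N 2%N j - 2 * t 2%N 3%N j + t 2%N 4%N j)).
    by apply: eq_bigr => j _; rewrite /t /moment_form ?ffactn0; ring.
  rewrite ?(big_split, sumrN) /= -?mulr_sumr !(A0, A1, A2, A3).
  rewrite /d3 /d2 /d; ring.
- transitivity (\sum_(j < N.+1) (16 * t 1%N 4%N j - 116 * t 1%N 5%N j + 273 *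
      t 1%N 6%N j - 263 * t 1%N 7%N j + 90 * t 1%N 8%N j + 39 * t 2%N 5%N j -
      12 * t 2%N 4%N j - 42 * t 2%N 6%N j + 15 * t 2%N 7%N j + 3 * t 3%N 4%N j
      - t 3%N 3%N j - 3 * t 3%N 5%N j + t 3%N 6%N j)).
    by apply: eq_bigr => j _; rewrite /t /moment_form ?ffactn0; ring.
  rewrite ?(big_split, sumrN) /= -?mulr_sumr !(A0, A1, A2, A3).
  rewrite /d3 /d2 /d; ring.
Qed.

(** The falling factorials of 0 vanish, and c_0 = N^N / N! - N^(N-1) / (N-1)! = 0. *)
Lemma forest_moment_N0 i N : (i <= 3)%N -> (0 < N)%N -> forest_moment i N 0 = 0.
Proof.
case: N => [//|N] i3 _; rewrite /forest_moment addn0 /moment_form !ffact0n.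
have c0 : expgeo 0 N.+1%:R N.+1 = 0.
  rewrite expgeo0E /= factS natrM exprS; field.
  by rewrite fact_neq0 nat1r pnatr_eq0.
by case: i i3 => [|[|[|[|//]]]] _ /=; rewrite ?c0; ring.
Qed.

(** At N = 0 every c_m is 1, and for i > 0 the weights in each bracket of [moment_form] add up to
    0. *)
Lemma forest_moment0 i k : (i <= 3)%N -> forest_moment i 0 k = (i == 0%N)%:R.
Proof.
move=> i3; rewrite /forest_moment.
by case: i i3 => [|[|[|[|//]]]] _; rewrite fact0 /moment_form /= !expgeo0; ring.
Qed.

(** * Forests with a single root *)

Lemma forest_moment_single N (n w : R) (mu := fun i => forest_moment i N 1) :
  n = N.+1%:R -> mu 1%N = w * mu 0%N ->
  mu 2%N = (5 / 3 * n ^+ 3 - 5 / 3 * n ^+ 2 - 17 / 6 * n * w) * mu 0%N /\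
  mu 3%N = (- (151 / 30) * n ^+ 4 + 76 / 15 * n ^+ 3 - 1 / 30 * n ^+ 2
            + (15 / 8 * n ^+ 3 + 157 / 24 * n ^+ 2 - 1 / 60 * n) * w) * mu 0%N.
Proof.
move=> nE; rewrite /mu /forest_moment /moment_form ffactn1.
rewrite !(@ffact_small 1) // !mul0r !addr0 addn1 -nE.
have [c cE] : exists c, forall m, expgeo m n N = c m 
  by exists (fun m => expgeo m n N).
(* The relation of [expgeo_size] for k = 1. It gives c_1 from c_0, and c_(m+2) from c_m and c_(m+1)
   for m > 0; c_2 stays free and carries w. *)
have r m : n * c m = c m.+1 + m%:R * (c m.+2 - c m.+1).
  rewrite -!cE; have := expgeo_size m N 1; rewrite addn1 -nE nE -natr1 => rm.
  by rewrite mulrDl rm; ring.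
rewrite !cE !mul1r mulrCA => Nw.
have wE : c 2%N - c 1%N = w * c 0%N by apply: (mulfI (fact_neq0 N)).
have c1 : c 1%N = n * c 0%N by rewrite r; ring.
have c2 : c 2%N = (n + w) * c 0%N by rewrite mulrDl -wE -c1; ring.
have c3 : c 3%N = n ^+ 2 * c 0%N by have := r 1%N; rewrite c1; lra.
have c4 : c 4%N = (n ^+ 2 + n * w / 2) * c 0%N.
  by have := r 2%N; rewrite c2 c3; lra.
have c5 : c 5%N = (n ^+ 3 / 3 + 2 / 3 * n ^+ 2 + n * w / 3) * c 0%N.
  by have := r 3%N; rewrite c3 c4; lra.
have c6 : c 6%N = (n ^+ 3 / 2 + n ^+ 2 / 2 + n ^+ 2 * w / 8 + n * w / 4)
                  * c 0%N.
  by have := r 4%N; rewrite c4 c5; lra.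
have c7 : c 7%N = (n ^+ 4 / 15 + 8 / 15 * n ^+ 3 + 2 / 5 * n ^+ 2
                   + n ^+ 2 * w / 6 + n * w / 5) * c 0%N.
  by have := r 5%N; rewrite c5 c6; lra.
have c8 : c 8%N = (5 / 36 * n ^+ 4 + 19 / 36 * n ^+ 3 + n ^+ 2 / 3
    + n ^+ 3 * w / 48 + 13 / 72 * n ^+ 2 * w + n * w / 6) * c 0%N.
  by have := r 6%N; rewrite c6 c7; lra.
by rewrite !(c3, c4, c5, c6, c7, c8); split; field.
Qed.

(** Cayley's number of trees on n = N + 1 vertices: n c_0 = c_1 = n^N / N!. *)
Lemma forest_moment01 N : forest_moment 0 N 1 = N.+1%:R ^+ N.-1.
Proof.
have := expgeo_size 0 N 1; rewrite /= addn1 mul1r mul0r addr0 => r.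
have {r} c1 : N.+1%:R * expgeo 0 N.+1%:R N = expgeo 1 N.+1%:R N.
  by rewrite -[X in X * _]natr1 mulrDl mul1r r subrK.
rewrite /forest_moment /moment_form addn1.
apply: (mulfI (_ : N.+1%:R != 0)); first by rewrite pnatr_eq0.
rewrite mulrCA c1 expgeo1.
case: N {c1} => [|N]; first by rewrite fact0 !expr0; field.
by rewrite -exprS; field; rewrite fact_neq0.
Qed.

(** The difference c_2 - c_1 is the sum of n^i / i! over i < N, so that the factor of
    [forest_moment 0 N 1] is W_n. *)
Lemma forest_moment11 N (n := N.+1) :
  forest_moment 1 N 1 =
  n`!%:R / n%:R ^+ n.-1 * (\sum_(0 <= k < n.-1) n%:R ^+ k / k`!%:R)
  * forest_moment 0 N 1.
Proof.
rewrite forest_moment01 /forest_moment /moment_form ffactn1 mul1r addn1 -/n.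
rewrite expgeoS; under eq_bigr do rewrite expgeo1.
rewrite big_ord_recr expgeo1 addrK big_mkord factS natrM [n.-1]/=.
case: N @n => [|N] n; first by rewrite !big_ord0 !mulr0 mul0r.
rewrite -/n exprS [N.+1.-1]/=; field.
by rewrite expf_neq0 ?pnatr_eq0.
Qed.

End Egf.

Local Close Scope ring_scope.

(** * Rooted forests and rooted trees as parent functions *)

Lemma find_iota (P : pred nat) n d :
  d < n -> P d -> (forall e, e < d -> ~~ P e) -> find P (iota 0 n) = d.
Proof.
move=> dn Pd Pe.
have -> : iota 0 n = iota 0 d ++ iota d (n - d).
  by rewrite -iotaD subnKC // ltnW.
rewrite find_cat ifN; last first.
  by apply/hasPn => e; rewrite mem_iota add0n => /andP[_ /Pe].
by rewrite size_iota (_ : n - d = (n - d).-1.+1) /= ?Pd ?addn0 //; lia.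
Qed.

Lemma set2_eq (T : finType) (a b c d : T) :
  [set a; b] = [set c; d] -> (a = c /\ b = d) \/ (a = d /\ b = c).
Proof.
move=> E.
have := set21 a b; have := set22 a b; have := set21 c d; have := set22 c d.
rewrite E -{1 2}E !in_set2.
by do 4![case/predU1P=> [?|/eqP ?]]; subst; auto.
Qed.

(** * Forests with a given root set, and the removal of their roots *)

Section Forests.
Variable V : finType.
Implicit Types (f g : {ffun V -> V}) (S R J : {set V}) (h : V -> nat).

(** Since h drops by one along f, its existence rules out cycles and forces every orbit from S into
    R. *)
Definition is_height f S R h :=
  (forall v, v \in R -> h v = 0) /\
  (forall v, v \in S -> f v \in S :|: R /\ h v = (h (f v)).+1).

(* A forest with root set R and set of other vertices S is given by its parent
   function, which is the identity outside S. *)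
Definition forests S R : {set {ffun V -> V}} :=
  [set f : {ffun V -> V} | `[< (forall v, v \notin S -> f v = v) /\
               exists h, is_height f S R h >]].

(** A search, so that the depth depends on f and R and not on a chosen height function. The value is
    #|V| if no root is found. *)
Definition depth R f v := find (fun d => iter d f v \in R) (iota 0 #|V|).

Definition level1 f S R := [set v in S | f v \in R].

(** The vertices of J become roots, where a parent function has to be the identity. *)
Definition prune J f : {ffun V -> V} := [ffun v => if v \in J then v else f v].

Lemma forestsP f S R :
  reflect ((forall v, v \notin S -> f v = v) /\ exists h, is_height f S R h)
          (f \in forests S R).
Proof. by rewrite inE; apply: asboolP. Qed.

Lemma is_height_iter f S R h v d : is_height f S R h -> v \in S :|: R ->
  d <= h v -> iter d f v \in S :|: R /\ h (iter d f v) = h v - d.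
Proof.
move=> [h0 hS] vSR; elim: d => [|d IH] dh; first by rewrite subn0.
have [iSR hi] := IH (ltnW dh).
have iS : iter d f v \in S.
  by case/setUP: iSR => // /h0 /eqP; rewrite hi subn_eq0 leqNgt dh.
by have [fSR hf] := hS _ iS; split=> //=; rewrite subnS -hi hf.
Qed.

Lemma is_height_root f S R h v : is_height f S R h -> v \in S :|: R ->
  (v \in R) = (h v == 0).
Proof.
move=> [h0 hS] vSR; apply/idP/eqP => [/h0 //|hv].
by case/setUP: vSR => // /hS[_]; rewrite hv.
Qed.

(** The iterates of f at v up to the h v-th have different heights, hence are h v + 1 distinct
    vertices. *)
Lemma is_height_lt_card f S R h v : is_height f S R h -> v \in S :|: R ->
  h v < #|V|.
Proof.
move=> fh vSR; rewrite -[(h v).+1]card_ord.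
apply: (@leq_card _ _ (fun d : 'I_(h v).+1 => iter d f v)).
move=> [d /= dh] [e /= eh] E; apply/val_inj => /=.
have [_ Hd] := is_height_iter fh vSR (dh : d <= h v).
have [_ He] := is_height_iter fh vSR (eh : e <= h v).
by move: Hd; rewrite E He; lia.
Qed.

Lemma depthE f S R h v : is_height f S R h -> v \in S :|: R ->
  depth R f v = h v.
Proof.
move=> fh vSR; apply: find_iota; first exact: is_height_lt_card fh vSR.
  have [iSR hi] := is_height_iter fh vSR (leqnn _).
  by rewrite (is_height_root fh iSR) hi subnn.
move=> e eh; have [iSR hi] := is_height_iter fh vSR (ltnW eh).
by rewrite (is_height_root fh iSR) hi subn_eq0 -ltnNge.
Qed.

Lemma prune_forest f S R : [disjoint S & R] -> f \in forests S R ->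
  prune (level1 f S R) f \in forests (S :\: level1 f S R) (level1 f S R).
Proof.
move=> SR /forestsP[fid [h [h0 hS]]]; apply/forestsP; split.
  move=> v; rewrite inE negb_and negbK ffunE; case: ifP => //= _.
  exact: fid.
(* The new roots had height 1 and the other vertices of S at least 2, so the predecessor is not
   truncated on S. *)
exists (fun v => (h v).-1); split=> v; rewrite !inE.
  by case/andP=> vS fR; have [_ ->] := hS _ vS; rewrite h0.
case/andP; rewrite negb_and => /orP[/negP //|fR] vS.
rewrite ffunE inE vS (negPf fR) /=.
have [/setUP[fS|]] := hS _ vS; last by rewrite (negPf fR).
have [_ hf] := hS _ fS; have [_ ->] := hS _ vS; rewrite hf ?inE ?fS.
by case: (f (f v) \in R).
Qed.

(** The height on R is set to 0 explicitly because h is unconstrained there. *)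
Lemma graft_height f g S R J h : [disjoint S & R] -> J \subset S ->
  is_height g (S :\: J) J h ->
  (forall v, v \in J -> f v \in R) -> (forall v, v \notin J -> f v = g v) ->
  is_height f S R (fun v => if v \in R then 0 else (h v).+1).
Proof.
move=> SR JS [h0 hS] fJ fg; split=> [v -> //|v vS].
rewrite (disjointFr SR vS); case: (boolP (v \in J)) => vJ.
  by rewrite fJ // h0 // inE fJ ?orbT.
have [gv ->] : g v \in (S :\: J) :|: J /\ h v = (h (g v)).+1.
  by apply: hS; rewrite inE vJ.
rewrite fg //; have gS : g v \in S.
  by case/setUP: gv => [/setDP[]//|]; apply/subsetP.
by rewrite (disjointFr SR gS) inE gS.
Qed.

(** The forests that peel to the pair (J, g): each vertex of J chooses its root freely, and f agrees
    with g elsewhere. As a [family] this set is counted by a product. *)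
Lemma graft_forest f g S R J : [disjoint S & R] -> J \subset S ->
  g \in forests (S :\: J) J ->
  [&& f \in forests S R, level1 f S R == J & prune J f == g] =
  (f \in family (fun v => if v \in J then mem R else mem (pred1 (g v)))).
Proof.
move=> SR JS gF; apply/and3P/familyP.
  move=> [fF /eqP JE /eqP gE] v; case: ifP => vJ.
    by move: vJ; rewrite -JE inE => /andP[].
  by rewrite -gE inE ffunE vJ.
move=> fam.
have fJ v : v \in J -> f v \in R by move=> vJ; have := fam v; rewrite vJ.
have fg v : v \notin J -> f v = g v.
  by move=> vJ; have := fam v; rewrite (negPf vJ) => /eqP.
have /forestsP[gid [h gh]] := gF.
split.
- apply/forestsP; split; last by eexists; exact: graft_height SR JS gh fJ fg.
  move=> v vS; have vJ : v \notin J by apply: contra vS; apply/subsetP.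
  by rewrite fg // gid // inE (negPf vS) andbF.
- apply/eqP/setP => v; rewrite inE; apply/andP/idP => [[vS]|vJ].
    apply: contraLR => vJ; rewrite fg //; apply/negP => gR.
    have [_ /(_ v)] := gh; rewrite inE vJ vS => -[] // /setUP gSJ _.
    have : g v \in S by case: gSJ => [/setDP[]//|]; apply/subsetP.
    by move/(disjointFr SR); rewrite gR.
  by rewrite fJ // (subsetP JS).
- apply/eqP/ffunP => v; rewrite ffunE; case: ifPn => [vJ|/fg //].
  by rewrite gid // inE vJ.
Qed.

(** Every vertex of S lies one level deeper than in g, where the vertices of J have depth 0. *)
Lemma sum_depth_graft f g S R J : [disjoint S & R] -> J \subset S ->
  g \in forests (S :\: J) J ->
  f \in family (fun v => if v \in J then mem R else mem (pred1 (g v))) ->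
  \sum_(v in S) depth R f v = #|S| + \sum_(v in S :\: J) depth J g v.
Proof.
move=> SR JS /forestsP[gid [h gh]] /familyP fam.
have fJ v : v \in J -> f v \in R by move=> vJ; have := fam v; rewrite vJ.
have fg v : v \notin J -> f v = g v.
  by move=> vJ; have := fam v; rewrite (negPf vJ) => /eqP.
have fh := graft_height SR JS gh fJ fg.
rewrite (eq_bigr (fun v => 1 + h v)); last first.
  move=> v vS; rewrite (depthE fh) ?inE ?vS //.
  by rewrite (disjointFr SR vS) add1n.
rewrite big_split /= sum1_card (big_setID J) /= (setIidPr JS).
rewrite big1 ?add0n => [|v /(proj1 gh) //]; congr (_ + _).
by apply: eq_bigr => v vSJ; rewrite (depthE gh) // inE vSJ.
Qed.

Lemma card_graft R J g :
  #|family (fun v => if v \in J then mem R else mem (pred1 (g v)))|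
  = #|R| ^ #|J|.
Proof.
rewrite card_family.
transitivity (\prod_(v : V) (if v \in J then #|R| else 1)).
  rewrite /image_mem foldrE big_map big_enum /=; apply: eq_bigr => v _.
  by case: ifP => _ //; rewrite card1.
by rewrite -big_mkcond /= prod_nat_const.
Qed.

(** The forests are sorted by the children J of the roots, then by the forest g that is left; each
    pair has |R|^|J| preimages. *)
Lemma big_forests_peel (A : nmodType) (F : nat -> A) S R : [disjoint S & R] ->
  (\sum_(f in forests S R) F (\sum_(v in S) depth R f v)%N =
  \sum_(J : {set V} | J \subset S)
    (\sum_(g in forests (S :\: J) J)
       F (#|S| + \sum_(v in S :\: J) depth J g v)%N) *+ (#|R| ^ #|J|))%R.
Proof.
move=> SR.
rewrite (partition_big (fun f => level1 f S R) (fun J => J \subset S)) /=;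
  last first.
  by move=> f _; apply/subsetP => v; rewrite inE => /andP[].
apply: eq_bigr => J JS.
rewrite (partition_big (prune J) (mem (forests (S :\: J) J))) /=; last first.
  by move=> f /andP[fF /eqP <-]; exact: prune_forest.
rewrite -sumrMnl; apply: eq_bigr => g gF.
rewrite (eq_bigl (mem (family (fun v =>
    if v \in J then mem R else mem (pred1 (g v))))));
  last by move=> f /=; rewrite -andbA graft_forest.
rewrite (eq_bigr (fun=> F (#|S| + \sum_(v in S :\: J) depth J g v)%N));
  last first.
  by move=> f fam; rewrite (sum_depth_graft SR JS gF fam).
by rewrite sumr_const card_graft.
Qed.

(** Iterating f from v exactly h v times reaches a vertex of height 0, which would be a root. *)
Lemma forests_set0 S : S != set0 -> forests S set0 = set0.
Proof.
move=> /set0Pn[v vS]; apply/setP => f; rewrite in_set0; apply/negbTE/negP.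
move=> /forestsP[_ [h fh]].
have vSR : v \in S :|: set0 by rewrite setU0.
have [iSR hi] := is_height_iter fh vSR (leqnn _).
by have := is_height_root fh iSR; rewrite hi subnn in_set0.
Qed.

Lemma forests_nil R : forests set0 R = [set [ffun v => v]].
Proof.
apply/setP => f; rewrite in_set1; apply/forestsP/eqP => [[fid _]|->].
  by apply/ffunP => v; rewrite ffunE fid // in_set0.
split=> [v _|]; first by rewrite ffunE.
by exists (fun=> 0); split=> // v; rewrite in_set0.
Qed.

Lemma sum_subset_card (A : nmodType) (phi : nat -> A) S :
  (\sum_(J : {set V} | J \subset S) phi #|J| =
   \sum_(j < #|S|.+1) phi j *+ 'C(#|S|, j))%R.
Proof.
rewrite (partition_big (fun J : {set V} => inord #|J| : 'I_#|S|.+1) predT) //=.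
apply: eq_bigr => j _; rewrite -cards_draws -sumr_const.
apply: eq_big => [J|J /andP[JS /eqP <-]]; last first.
  by rewrite inordK // ltnS subset_leq_card.
rewrite inE; case: (boolP (J \subset S)) => //= JS.
by rewrite -val_eqE /= inordK // ltnS subset_leq_card.
Qed.

Lemma forests_moment (A : realFieldType) i S R : i <= 3 -> [disjoint S & R] ->
  (\sum_(f in forests S R) (\sum_(v in S) depth R f v)%:R ^+ i)%R =
  forest_moment A i #|S| #|R|.
Proof.
have [m] := ubnP #|S|; elim: m => // m IHm in S R i *; rewrite ltnS => Sm i3 SR.
have [->|S0] := eqVneq S set0.
  rewrite forests_nil big_set1 big_set0 cards0 forest_moment0 // expr0n.
  by case: i {i3}.
rewrite (big_forests_peel (fun d => d%:R ^+ i : A)%R SR).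
rewrite forest_moment_rec //; pose N := #|S|.
pose phi j : A := (\sum_(l < i.+1) 'C(i, l)%:R * N%:R ^+ (i - l) *
   forest_moment A l (N - j) j *+ (#|R| ^ j))%R.
transitivity (\sum_(J : {set V} | J \subset S) phi #|J|)%R.
  apply: eq_bigr => J JS; rewrite /phi sumrMnl; congr (_ *+ _)%R.
  have SJ : #|S :\: J| = (N - #|J|)%N by rewrite cardsDS.
  (* The lost level contributes N to the total, and the binomial theorem produces the factors
     N^(i-l). *)
  under eq_bigr do rewrite natrD exprDn.
  rewrite exchange_big /=; apply: eq_bigr => -[l /= li] _.
  under eq_bigr do rewrite -mulr_natl mulrA.
  rewrite -mulr_sumr; congr (_ * _)%R.
  (* For empty J the set S does not shrink and the induction hypothesis does not apply; both sides
     are 0. *)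
  have [J0|J0] := eqVneq J set0.
    rewrite J0 setD0 forests_set0 // big_set0 cards0 subn0 forest_moment_N0 //.
      exact: leq_trans i3.
    by rewrite card_gt0.
  rewrite IHm ?SJ //.
  - rewrite (leq_trans _ Sm) // ltn_subrL card_gt0 J0 /=.
    by rewrite card_gt0.
  - exact: leq_trans i3.
  - by rewrite disjoints_subset; apply/subsetP => v; rewrite !inE => /andP[].
rewrite sum_subset_card; apply: eq_bigr => j _.
rewrite -[LHS]mulr_natr mulr_suml mulr_sumr; apply: eq_bigr => l _.
by rewrite -[X in (X * _)%R = _]mulr_natr natrX -/N; ring.
Qed.

End Forests.

(** * Trees with a fixed root r as parent functions *)

Section ParentTrees.
Variables (V : finType) (r : V).
Implicit Types (f g : {ffun V -> V}) (E : {set {set V}}) (u v : V).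

Let S := ~: [set r].
Let R := [set r].

Definition parent_edges f := [set [set v; f v] | v in S].

Lemma rootU : S :|: R = [set: V]. Proof. by rewrite setUC setUCr. Qed.

Lemma in_S v : (v \in S) = (v != r). Proof. by rewrite !inE. Qed.

Lemma adj_sym E : symmetric (adj E).
Proof. by move=> u v; rewrite /adj setUC. Qed.

Lemma adj_parent f u v :
  reflect ((u != r /\ v = f u) \/ (v != r /\ u = f v))
          (adj (parent_edges f) u v).
Proof.
apply: (iffP imsetP) => [[w]|].
  by rewrite in_S => wr /set2_eq[[-> ->]|[-> ->]]; [left|right].
by case=> -[xr ->]; [exists u|exists v]; rewrite ?in_S // setUC.
Qed.

Section Height.
Variables (f : {ffun V -> V}) (h : V -> nat).
Hypothesis fh : is_height f S R h.

Lemma heightS v : v != r -> h v = (h (f v)).+1.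
Proof. by rewrite -in_S => /(proj2 fh)[]. Qed.

Lemma height_root : h r = 0. Proof. by apply: (proj1 fh); rewrite set11. Qed.

Lemma height_depth v : depth R f v = h v.
Proof. by apply: depthE fh _; rewrite rootU inE. Qed.

Lemma height_lt_card v : h v < #|V|.
Proof. by apply: is_height_lt_card fh _; rewrite rootU inE. Qed.

(** The other neighbours of v are its children, which are higher by one. *)
Lemma adj_parent_le u v : adj (parent_edges f) v u -> h u <= h v -> u = f v.
Proof.
by case/adj_parent=> [[]//|[ur ->]]; rewrite (heightS ur) ltnn.
Qed.

Lemma walk_to_root v : has_walk (parent_edges f) v r (h v).
Proof.
move: {2 3}(h v) (erefl (h v)) => d.
elim: d v => [|d IH] v hv.
  apply/existsP; exists [tuple] => /=; apply: contraT => /heightS.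
  by rewrite hv.
have vr : v != r by apply: contra_eq_neq hv => ->; rewrite height_root.
have /IH/existsP[p /andP[fp lp]] : h (f v) = d.
  by move: hv; rewrite heightS // => -[].
apply/existsP; exists [tuple of f v :: p] => /=; rewrite fp lp !andbT.
by apply/adj_parent; left.
Qed.

(** An edge changes the height by one, so a walk to the root has at least h u edges. *)
Lemma height_path u p : path (adj (parent_edges f)) u p ->
  h u <= h (last u p) + size p.
Proof.
elim: p u => [|v p IH] u /=; first by rewrite addn0.
case/andP=> /adj_parent uv /IH le_v.
have : h u <= (h v).+1.
  by case: uv => -[xr ->]; rewrite ?(heightS xr) // ltnW // ltnW.
by move=> /leq_trans -> //; rewrite addnS ltnS.
Qed.

Lemma graph_dist_parent v : graph_dist (parent_edges f) v r = h v.
Proof.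
apply: find_iota; [exact: height_lt_card|exact: walk_to_root|move=> e eh].
apply/negP => /existsP[p /andP[/height_path fp /eqP lp]].
by move: fp; rewrite lp height_root size_tuple leqNgt eh.
Qed.

Lemma parent_simple : simple_graph (parent_edges f).
Proof.
move=> e /imsetP[v]; rewrite in_S => vr ->; rewrite cards2.
case: eqVneq => // vf; have := heightS vr; rewrite -vf => /eqP.
by rewrite ltn_eqF.
Qed.

Lemma parent_connected : connected_graph (parent_edges f).
Proof.
have to_r v : connect (adj (parent_edges f)) v r.
  have /existsP[p /andP[fp /eqP lp]] := walk_to_root v.
  by apply/connectP; exists p.
move=> u v; apply: connect_trans (to_r u) _.
by rewrite (sym_connect_sym (adj_sym _)).
Qed.

Lemma parent_acyclic : acyclic_graph (parent_edges f).
Proof.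
move=> c cyc; rewrite leqNgt; apply/negP => c3.
have [x xc] : exists x, x \in c.
  by case: c c3 {cyc} => // x c _; exists x; rewrite mem_head.
(* At a vertex v of maximal height both neighbours on the cycle are the parent of v, whereas a cycle
   with at least three vertices makes them distinct. *)
have [v vc vmax] := arg_maxnP h xc.
have [i c' cE] := rot_to vc.
have : ucycle (adj (parent_edges f)) (v :: c') by rewrite -cE rot_ucycle.
have : {in v :: c', forall u, h u <= h v}.
  by move=> u; rewrite -cE mem_rot => /vmax.
have : 2 < size (v :: c') by rewrite -cE size_rot.
case: c' {cE} => [//|a c']; case: (lastP c') => [//|c'' b] _ hmax.
case/andP => /=; rewrite -rcons_cons rcons_path last_rcons.
case/andP=> va /andP[_ bv] /andP[_ /andP[ab _]].
have av : a = f v.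
  by apply: adj_parent_le va _; apply: hmax; rewrite !inE eqxx orbT.
have : b = f v.
  rewrite adj_sym in bv; apply: adj_parent_le bv _; apply: hmax.
  by rewrite !inE mem_rcons inE eqxx !orbT.
by move: ab; rewrite -av => /[swap] ->; rewrite mem_rcons inE eqxx.
Qed.

End Height.

Lemma parent_tree f : f \in forests S R -> is_tree (parent_edges f).
Proof.
case/forestsP => _ [h fh].
split; first exact: parent_simple fh.
  exact: parent_connected fh.
exact: parent_acyclic fh.
Qed.

Lemma graph_dist_depth f v : f \in forests S R ->
  graph_dist (parent_edges f) v r = depth R f v.
Proof.
by case/forestsP=> _ [h fh]; rewrite (graph_dist_parent fh) (height_depth fh).
Qed.

Lemma parent_edges_inj : {in forests S R &, injective parent_edges}.
Proof.
move=> f g fF gF E; apply/ffunP => v.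
have /forestsP[fid [h fh]] := fF; have /forestsP[gid [k gk]] := gF.
have hk u : h u = k u.
  by rewrite -(graph_dist_parent fh) E (graph_dist_parent gk).
have [->|vr] := eqVneq v r; first by rewrite fid ?gid // in_S eqxx.
(* In the tree of g, either f v is the parent of v, as wanted, or v is the parent of f v. The latter
   contradicts h = k, since h decreases from v to f v. *)
have : adj (parent_edges f) v (f v) by apply/adj_parent; left.
rewrite E => /adj_parent[[] // |[fr vE]].
have := heightS gk fr; have := heightS fh vr; rewrite -vE !hk; lia.
Qed.

Lemma has_walkP E u v d :
  reflect (exists p, [/\ path (adj E) u p, last u p = v & size p = d])
          (has_walk E u v d).
Proof.
apply: (iffP existsP) => [[p /andP[up /eqP lp]]|[p [up lp <-]]].
  by exists p; rewrite size_tuple.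
by exists (in_tuple p); rewrite up lp /=.
Qed.

Lemma graph_dist_walk E u v : connected_graph E ->
  graph_dist E u v < #|V| /\ has_walk E u v (graph_dist E u v).
Proof.
move=> cE; have /connectP[p up vp] := cE u v.
(* A path without repeated vertices has fewer than #|V| edges, hence lies in the range searched by
   [graph_dist]. *)
have [q uq] : exists2 q, path (adj E) u q & v = last u q /\ uniq (u :: q).
  by case/shortenP: up vp => q uq Uq _ vq; exists q.
case=> vq Uq.
have hasw : has (has_walk E u v) (iota 0 #|V|).
  apply/hasP; exists (size q); last by apply/has_walkP; exists q.
  rewrite mem_iota /= add0n -[(size q).+1]/(size (u :: q)).
  by rewrite -(card_uniqP Uq) max_card.
have lt : graph_dist E u v < #|V|.
  by rewrite /graph_dist -{2}(size_iota 0 #|V|) -has_find.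
by split=> //; have := nth_find 0 hasw; rewrite nth_iota.
Qed.

Lemma graph_dist_le E u v d : has_walk E u v d -> graph_dist E u v <= d.
Proof.
move=> w; rewrite leqNgt; apply/negP => lt.
have := before_find 0 lt; rewrite nth_iota ?add0n ?w //.
by rewrite (leq_trans lt) // /graph_dist -{2}(size_iota 0 #|V|) find_size.
Qed.

Lemma graph_dist_root E : graph_dist E r r = 0.
Proof.
by apply/eqP; rewrite -leqn0 graph_dist_le //; apply/has_walkP; exists [::].
Qed.

(** The second vertex of a shortest walk to r will do. *)
Lemma graph_dist_step E v : connected_graph E -> v != r ->
  exists u, adj E v u && (graph_dist E v r == (graph_dist E u r).+1).
Proof.
move=> cE vr; have [_ /has_walkP[p [vp lp sp]]] := graph_dist_walk v r cE.
case: p vp lp sp => [|u p] /= vp lp sp; first by rewrite lp eqxx in vr.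
case/andP: vp => vu up; exists u; rewrite vu /= eqn_leq; apply/andP; split.
  have [_ /has_walkP[q [uq lq <-]]] := graph_dist_walk u r cE.
  by apply: graph_dist_le; apply/has_walkP; exists (u :: q); rewrite /= vu.
by rewrite -sp ltnS; apply: graph_dist_le; apply/has_walkP; exists p.
Qed.

(* Each vertex other than r gets a neighbour closer to r as its parent. An edge
   outside the resulting spanning tree would close a cycle. *)
Lemma tree_parent_edges E : is_tree E ->
  exists2 f, f \in forests S R & parent_edges f = E.
Proof.
case=> sE cE aE; pose d v := graph_dist E v r.
pose P v u := adj E v u && (d v == (d u).+1).
(* For v other than r the [pick] succeeds by [graph_dist_step]. *)
pose f := [ffun v => if v == r then r else odflt v [pick u | P v u]].
have fP v : v != r -> P v (f v).
  move=> vr; rewrite ffunE (negPf vr); case: pickP => //= noP.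
  by have [u] := graph_dist_step cE vr; rewrite -/(d v) -/(d u) -/(P v u) noP.
have fF : f \in forests S R.
  apply/forestsP; split=> [v|].
    by rewrite in_S negbK => /eqP ->; rewrite ffunE eqxx.
  exists d; split=> v; first by move/set1P->; apply: graph_dist_root.
  by rewrite in_S rootU inE => /fP/andP[_ /eqP].
have subE : parent_edges f \subset E.
  by apply/subsetP => e /imsetP[v]; rewrite in_S => /fP/andP[vf _] ->.
exists f => //; apply/eqP; rewrite eqEsubset subE /=; apply/subsetP => e eE.
have /eqP/cards2P[u [v [uv eq_e]]] := sE _ eE; move: eE; rewrite {}eq_e => uvE.
apply: contraT => uvf.
have [_ cf _] := parent_tree fF.
have /connectP[p up vp] := cf u v.
have [q uq] : exists2 q, path (adj (parent_edges f)) u q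
    & v = last u q /\ uniq (u :: q).
  by case/shortenP: up vp => q uq Uq _ vq; exists q.
case=> vq Uq.
(* The edge from v to u closes the tree path. Acyclicity of E allows at most two vertices, so the
   path is that edge itself. *)
have : ucycle (adj E) (u :: q).
  rewrite /ucycle Uq andbT /= rcons_path -vq adj_sym /adj uvE andbT.
  by apply: sub_path uq => x y; apply: (subsetP subE).
move/aE; case: q uq vq Uq => [|w [|//]] /=.
  by move=> _ vu; rewrite vu eqxx in uv.
by rewrite andbT => uw vw _; rewrite -vw /adj in uw; rewrite uw in uvf.
Qed.

End ParentTrees.

Local Open Scope ring_scope.

(** * Sums over all rooted trees *)

Lemma sum_rooted_trees (A : realFieldType) n (i : nat) :
  (0 < n)%N -> (i <= 3)%N ->
  \sum_(t in rooted_trees n) (total_height t)%:R ^+ i =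
  n%:R * forest_moment A i n.-1 1.
Proof.
move=> n0 i3.
(* A rooted tree is a pair of an edge set and a root; all n roots give the same sum. *)
transitivity (\sum_(r < n)
    \sum_(E | `[< is_tree E >]) (total_height (E, r))%:R ^+ i : A).
  rewrite exchange_big pair_big /=; apply: eq_big => [[E r]|[E r] _] //=.
  by rewrite inE andbT.
transitivity (\sum_(r < n) forest_moment A i n.-1 1); last first.
  by rewrite sumr_const card_ord mulr_natl.
apply: eq_bigr => r _.
rewrite (eq_bigl (mem (parent_edges r @: forests (~: [set r]) [set r])));
  last first.
  move=> E; apply/asboolP/imsetP => [/(tree_parent_edges r)[f fF <-]|[f fF ->]].
    by exists f.
  exact: parent_tree fF.
rewrite big_imset /=; last exact: parent_edges_inj.
have -> : n.-1 = #|~: [set r]| by rewrite cardsC1 card_ord.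
rewrite -[in RHS](cards1 r) -forests_moment //; last first.
  by rewrite disjoint_sym -subsets_disjoint.
apply: eq_bigr => f fF; congr (_%:R ^+ _).
rewrite /total_height (bigD1 r) //= [height _ _]graph_dist_root add0n.
apply: eq_big => [v|v _]; first by rewrite !inE.
exact: graph_dist_depth.
Qed.

Lemma card_rooted_trees (A : realFieldType) n : (0 < n)%N ->
  #|rooted_trees n|%:R = n%:R * forest_moment A 0 n.-1 1.
Proof.
move=> n0; rewrite -sum_rooted_trees // -sum1_card natr_sum.
by apply: eq_bigr => t _; rewrite expr0.
Qed.

(* Imported only here because classical_sets shadows the names of finset. *)
From mathcomp Require Import all_classical all_reals all_analysis.
Import Order.TTheory GRing.Theory Num.Theory.
Import numFieldNormedType.Exports.
Local Open Scope classical_set_scope.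
Local Open Scope ring_scope.

(** * Exact moments *)

Section ExactMoments.
Variable R : realType.

Section CentralMoments.
Variables (T : finType) (A : {set T}) (f : T -> R).
Hypothesis A0 : #|A|%:R != 0 :> R.

(** Four terms cover the polynomials of degree at most 3 in f that the central moments need. *)
Lemma unif_mean_sum (g : 'I_4 -> T -> R) (c : 'I_4 -> R) :
  unif_mean A (fun x => \sum_i c i * g i x) = \sum_i c i * unif_mean A (g i).
Proof.
rewrite /unif_mean exchange_big /= mulr_suml; apply: eq_bigr => i _.
by rewrite mulrA mulr_sumr.
Qed.

Lemma unif_mean_cst (a : R) : unif_mean A (fun=> a) = a.
Proof. by rewrite /unif_mean sumr_const -[a *+ _]mulr_natr mulfK. Qed.

Let mu i := unif_mean A (fun x => f x ^+ i).

Lemma mu1E : unif_mean A f = mu 1%N. Proof. by []. Qed.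

Lemma central_moment2E : central_moment A f 2 = mu 2%N - mu 1%N ^+ 2.
Proof.
rewrite /central_moment mu1E.
(* The coefficients of (f x - mu 1)^2 in powers of f x, padded by 0. *)
pose c (i : 'I_4) := [:: mu 1%N ^+ 2; - 2 * mu 1%N; 1; 0]`_i.
transitivity (unif_mean A (fun x => \sum_i c i * f x ^+ (val i))).
  congr (unif_mean _ _); apply/funext => x.
  by rewrite !big_ord_recr big_ord0 /c /=; ring.
rewrite (unif_mean_sum (fun (i : 'I_4) x => f x ^+ val i)).
have mu0 : mu 0%N = 1 by rewrite -(unif_mean_cst 1).
rewrite !big_ord_recr big_ord0 /c /=.
by rewrite -/(mu 0%N) -/(mu 1%N) -/(mu 2%N) mu0; ring.
Qed.

Lemma central_moment3E :
  central_moment A f 3 = mu 3%N - 3 * mu 1%N * mu 2%N + 2 * mu 1%N ^+ 3.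
Proof.
rewrite /central_moment mu1E.
pose c (i : 'I_4) := [:: - mu 1%N ^+ 3; 3 * mu 1%N ^+ 2; - 3 * mu 1%N; 1]`_i.
transitivity (unif_mean A (fun x => \sum_i c i * f x ^+ (val i))).
  congr (unif_mean _ _); apply/funext => x.
  by rewrite !big_ord_recr big_ord0 /c /=; ring.
rewrite (unif_mean_sum (fun (i : 'I_4) x => f x ^+ val i)).
have mu0 : mu 0%N = 1 by rewrite -(unif_mean_cst 1).
rewrite !big_ord_recr big_ord0 /c /=.
by rewrite -/(mu 0%N) -/(mu 1%N) -/(mu 2%N) -/(mu 3%N) mu0; ring.
Qed.

End CentralMoments.

Lemma forest_moment01_neq0 N : forest_moment R 0 N 1 != 0.
Proof. by rewrite forest_moment01 expf_neq0 // pnatr_eq0. Qed.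

Lemma card_rooted_trees_neq0 n : (0 < n)%N -> #|rooted_trees n|%:R != 0 :> R.
Proof.
move=> n0; rewrite card_rooted_trees // mulf_neq0 ?forest_moment01_neq0 //.
by rewrite pnatr_eq0 -lt0n.
Qed.

Lemma unif_mean_X n i : (0 < n)%N -> (i <= 3)%N ->
  unif_mean (rooted_trees n) (fun t => X R t ^+ i) =
  forest_moment R i n.-1 1 / forest_moment R 0 n.-1 1.
Proof.
move=> n0 i3; rewrite /unif_mean sum_rooted_trees // card_rooted_trees //.
by field; rewrite forest_moment01_neq0 pnatr_eq0 -lt0n.
Qed.

Lemma unif_mean_XE n (m : R)
    (mu := fun i => unif_mean (rooted_trees n) (fun t => X R t ^+ i)) :
  (0 < n)%N -> m = n%:R ->
  [/\ mu 1%N = W R n,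
      mu 2%N = 5 / 3 * m ^+ 3 - 5 / 3 * m ^+ 2 - 17 / 6 * m * W R n
    & mu 3%N = - (151 / 30) * m ^+ 4 + 76 / 15 * m ^+ 3 - 1 / 30 * m ^+ 2
            + (15 / 8 * m ^+ 3 + 157 / 24 * m ^+ 2 - 1 / 60 * m) * W R n].
Proof.
case: n @mu => [//|N] mu _ mE; have H := forest_moment11 R N.
have [m2 m3] := forest_moment_single mE H.
rewrite /mu !unif_mean_X // [N.+1.-1]/= H m2 m3.
by rewrite !mulfK ?forest_moment01_neq0.
Qed.

Lemma variance_XE n : (0 < n)%N ->
  variance_X R n = 5 / 3 * n%:R ^+ 3 - 5 / 3 * n%:R ^+ 2 - 17 / 6 * n%:R * W R n
                   - W R n ^+ 2.
Proof.
move=> n0; have [m1 m2 _] := unif_mean_XE n0 erefl.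
by rewrite /variance_X central_moment2E ?card_rooted_trees_neq0 // m1 m2.
Qed.

Lemma third_momentE n : (0 < n)%N ->
  third_moment R n =
    2 * W R n ^+ 3 + 17 / 2 * n%:R * W R n ^+ 2
    + (- (25 / 8) * n%:R ^+ 3 + 277 / 24 * n%:R ^+ 2 - 1 / 60 * n%:R) * W R n
    - 151 / 30 * n%:R ^+ 4 + 76 / 15 * n%:R ^+ 3 - 1 / 30 * n%:R ^+ 2.
Proof.
move=> n0; have [m1 m2 m3] := unif_mean_XE n0 erefl.
rewrite /third_moment central_moment3E ?card_rooted_trees_neq0 // m1 m2 m3.
by field.
Qed.

End ExactMoments.

(** * The asymptotics of W *)

Section GaussSums.
Variable R : realType.
Implicit Types (x y a b s : R) (n m i j : nat).
Local Notation mu := (@lebesgue_measure R).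

Definition gauss_int x : R := \int[mu]_(t in `[0, x]) gauss_fun t.

Lemma integrable_gauss (D : set R) : measurable D ->
  mu.-integrable D (EFin \o gauss_fun).
Proof.
move=> mD; apply: (integrableS measurableT) => //; exact: integrableT_gauss.
Qed.

Lemma gauss_fun_homo a b : 0 <= a -> a <= b -> gauss_fun b <= gauss_fun a.
Proof.
move=> a0 ab; rewrite /gauss_fun ler_expR lerN2 lerXn2r // nnegrE //.
exact: le_trans ab.
Qed.

Lemma gauss_int_itv a b : 0 <= a -> a <= b ->
  gauss_int b - gauss_int a = \int[mu]_(t in `]a, b]) gauss_fun t.
Proof.
move=> a0 ab; rewrite /gauss_int Rintegral_itvB //.
exact: integrable_gauss.
Qed.

(** The integrand decreases on the nonnegative axis, so its values at the endpoints bound it. *)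
Lemma gauss_int_increment a b : 0 <= a -> a <= b ->
  (b - a) * gauss_fun b <= gauss_int b - gauss_int a <= (b - a) * gauss_fun a.
Proof.
move=> a0 ab; rewrite gauss_int_itv //.
have icst c : mu.-integrable `]a, b] (EFin \o cst c).
  apply: (@integrableS _ _ _ mu `[a, b]) => //; first exact: subset_itv_oc_cc.
  apply: continuous_compact_integrable; first exact: segment_compact.
  by apply: continuous_subspaceT => z; exact: cst_continuous.
have E c : (b - a) * c = \int[mu]_(t in `]a, b]) cst c t.
  rewrite Rintegral_cst //= lebesgue_measure_itv /= lte_fin.
  by move: ab; rewrite le_eqVlt => /predU1P[->|->]; rewrite ?ltxx /=; ring.
rewrite !E; apply/andP; split; apply: le_Rintegral => //=.
- exact: integrable_gauss.
- by move=> x; rewrite in_itv /= => /andP[ax xb]; apply: gauss_fun_homo; lra.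
- exact: integrable_gauss.
- by move=> x; rewrite in_itv /= => /andP[ax xb]; apply: gauss_fun_homo; lra.
Qed.

Lemma gauss_int0 : gauss_int 0 = 0.
Proof. by rewrite /gauss_int set_itv1 Rintegral_set1. Qed.

(** The known limit is that of the square, pi / 4; the root is taken because [gauss_int] is
    nonnegative. *)
Lemma cvg_gauss_int : gauss_int x @[x --> +oo] --> Num.sqrt pi / 2.
Proof.
have : Num.sqrt (gauss_int x ^+ 2) @[x --> +oo] --> Num.sqrt (pi / 4 : R).
  apply: continuous_cvg; first exact: sqrt_continuous.
  exact: gauss_integral_proof.cvg_integral0_gauss_sqr.
rewrite sqrtrM ?pi_ge0// sqrtrV// (_ : 4 = 2 ^+ 2); last by ring.
rewrite sqrtr_sqr ger0_norm// (_ : (fun _ => Num.sqrt _) = gauss_int) //.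
apply/funext => x; rewrite sqrtr_sqr ger0_norm //.
exact: gauss_integral_proof.integral0_gauss_ge0.
Qed.

Lemma gauss_int_homo a b : 0 <= a -> a <= b -> gauss_int a <= gauss_int b.
Proof.
move=> a0 ab; have /andP[+ _] := gauss_int_increment a0 ab.
rewrite -[gauss_int a <= _]subr_ge0; apply: le_trans.
by rewrite mulr_ge0 ?subr_ge0 // expR_ge0.
Qed.

Lemma gauss_int_le x : 0 <= x -> gauss_int x <= Num.sqrt pi / 2.
Proof.
move=> x0; apply: (cvgr_to_ge cvg_gauss_int); near=> y.
by apply: gauss_int_homo => //; near: y; exact: nbhs_pinfty_ge.
Unshelve. all: by end_near. Qed.

Lemma gauss_int_le_id x : 0 <= x -> gauss_int x <= x.
Proof.
move=> x0; have /andP[_] := gauss_int_increment (lexx 0) x0.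
by rewrite gauss_int0 /gauss_fun expr0n /= oppr0 expR0; lra.
Qed.

(** A sum over right endpoints of a decreasing function. *)
Lemma gauss_sum_le s n : 0 <= s ->
  s * \sum_(1 <= i < n.+1) gauss_fun (s * i%:R) <= gauss_int (s * n%:R).
Proof.
move=> s0; elim: n => [|n IH].
  by rewrite big_geq // !mulr0 gauss_int0.
rewrite big_nat_recr //= mulrDr.
have ns0 : 0 <= s * n%:R by rewrite mulr_ge0.
have le_s : s * n%:R <= s * n.+1%:R by rewrite ler_wpM2l // ler_nat.
have /andP[+ _] := gauss_int_increment ns0 le_s.
rewrite -mulrBr -natrB // subSnn mulr1; lra.
Qed.

(** A sum over left endpoints of a decreasing function. *)
Lemma gauss_sum_ge s m n : 0 <= s -> (m <= n)%N ->
  gauss_int (s * n%:R) - gauss_int (s * m%:R)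
  <= s * \sum_(m <= i < n) gauss_fun (s * i%:R).
Proof.
move=> s0; elim: n => [|n IH] mn.
  by move: mn; rewrite leqn0 => /eqP ->; rewrite big_geq // mulr0 subrr.
move: mn; rewrite leq_eqVlt => /predU1P[->|].
  by rewrite big_geq // mulr0 subrr.
rewrite ltnS => mn; rewrite big_nat_recr //= mulrDr.
have ns0 : 0 <= s * n%:R by rewrite mulr_ge0.
have le_s : s * n%:R <= s * n.+1%:R by rewrite ler_wpM2l // ler_nat.
have /andP[_ +] := gauss_int_increment ns0 le_s.
rewrite -mulrBr -natrB // subSnn mulr1; have := IH mn; lra.
Qed.

(** The product of 1 - i/n over i < j. *)
Definition ffact_ratio n j : R := (n ^_ j)%:R / n%:R ^+ j.

Lemma ffact_ratio_ge0 n j : 0 <= ffact_ratio n j.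
Proof. by rewrite divr_ge0 // exprn_ge0. Qed.

Lemma ffact_ratioS n j : (0 < n)%N -> (j <= n)%N ->
  ffact_ratio n j.+1 = ffact_ratio n j * (1 - j%:R / n%:R).
Proof.
case: n => [//|n] _ jn.
rewrite /ffact_ratio ffactnSr natrM natrB // exprSr; field.
by rewrite expf_neq0 ?nat1r pnatr_eq0.
Qed.

(** Substitution k = n - j in the sum defining W_n. *)
Lemma W_ffact n : W R n = n%:R * \sum_(2 <= j < n.+1) ffact_ratio n j.
Proof.
case: n => [|n]; first by rewrite /W big_geq // mulr0 mul0r.
rewrite /W [n.+1.-1]/= !big_add1 /= big_nat_rev /= !mulr_sumr.
apply: eq_big_nat => i /= ltin; rewrite add0n /ffact_ratio.
rewrite -(ffact_fact (n := n.+1) (m := i.+2)) // natrM subSS.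
rewrite -[X in n.+1%:R ^+ X](subnK ltin) exprD !exprS; field.
rewrite !expf_neq0 ?nat1r ?pnatr_eq0 //= -lt0n.
by rewrite fact_gt0.
Qed.

(** From 1 - t <= e^(-t), as the i < j add up to j (j-1) / 2. *)
Lemma ffact_ratio_le n j : (0 < n)%N -> (j <= n)%N ->
  ffact_ratio n j <= expR (- (j%:R * (j%:R - 1)) / (2 * n%:R)).
Proof.
move=> n0; elim: j => [|j IH] jn.
  by rewrite /ffact_ratio divr1 ffactn0 !(mul0r, oppr0) expR0.
have n0' : n%:R != 0 :> R by rewrite pnatr_eq0 -lt0n.
have -> : - (j.+1%:R * (j.+1%:R - 1)) / (2 * n%:R) =
    - (j%:R * (j%:R - 1)) / (2 * n%:R) + - (j%:R / n%:R) :> R.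
  by rewrite -natr1; field.
rewrite ffact_ratioS ?(ltnW jn) // expRD ler_pM ?ffact_ratio_ge0 //.
- by rewrite subr_ge0 ler_pdivrMr ?ltr0n // mul1r ler_nat ltnW.
- exact/IH/ltnW.
- exact: expR_ge1Dx.
Qed.

(** For i <= m, n / (n-i) = 1 + i / (n-i) <= 1 + i / (n-m) <= e^(i/(n-m)), which bounds each factor
    1 - i/n from below. *)
Lemma ffact_ratio_ge n m j : (m < n)%N -> (j <= m)%N ->
  expR (- j%:R ^+ 2 / (2 * (n%:R - m%:R))) <= ffact_ratio n j.
Proof.
move=> mn; elim: j => [|j IH] jm.
  by rewrite /ffact_ratio divr1 ffactn0 expr0n !(mul0r, oppr0) expR0.
have d0 : 0 < n%:R - m%:R :> R by rewrite subr_gt0 ltr_nat.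
have jn : (j < n)%N by rewrite (leq_trans jm) // ltnW.
have n0 : 0 < n%:R :> R by rewrite ltr0n; exact: leq_ltn_trans mn.
have jn' : 0 < n%:R - j%:R :> R by rewrite subr_gt0 ltr_nat.
apply: (@le_trans _ _ (expR (- j%:R ^+ 2 / (2 * (n%:R - m%:R)))
                       * expR (- (j%:R / (n%:R - m%:R))))).
  rewrite -expRD ler_expR -subr_ge0 -(natr1 j).
  suff -> : - j%:R ^+ 2 / (2 * (n%:R - m%:R)) + - (j%:R / (n%:R - m%:R))
    - - (j%:R + 1) ^+ 2 / (2 * (n%:R - m%:R)) = (2 * (n%:R - m%:R))^-1 :> R.
    by rewrite invr_ge0 mulr_ge0 // ltW.
  by field; rewrite gt_eqF.
rewrite ffact_ratioS ?(ltnW jn) -?(ltr0n R) // ler_pM ?expR_ge0 //.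
  exact/IH/ltnW.
rewrite expRN -[leRHS]invrK lef_pV2 ?posrE ?expR_gt0 ?invr_gt0 //; last first.
  by rewrite subr_gt0 ltr_pdivrMr // mul1r ltr_nat.
apply: le_trans (expR_ge1Dx _).
have -> : (1 - j%:R / n%:R)^-1 = n%:R / (n%:R - j%:R) :> R.
  by field; rewrite !gt_eqF.
rewrite ler_pdivrMr // -subr_ge0.
have -> : (1 + j%:R / (n%:R - m%:R)) * (n%:R - j%:R) - n%:R =
   j%:R * (m%:R - j%:R) / (n%:R - m%:R) :> R by field; rewrite gt_eqF.
by rewrite divr_ge0 ?mulr_ge0 ?subr_ge0 ?ler_nat 1?ltnW // -subr_gt0.
Qed.

Lemma gauss_fun_sqrt x y :
  0 < x -> gauss_fun ((Num.sqrt x)^-1 * y) = expR (- y ^+ 2 / x).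
Proof.
by move=> x0; rewrite /gauss_fun exprMn exprVn sqr_sqrtr ?ltW // mulrC mulNr.
Qed.

(** As j (j-1) >= (j-1)^2, shifting the index by one gives a right endpoint sum with step 1 / sqrt
    (2 n). *)
Lemma W_le n : W R n <= n%:R * (Num.sqrt (2 * n%:R) * (Num.sqrt pi / 2)).
Proof.
case: n => [|n]; first by rewrite /W big_geq // mulr0 mul0r.
have x0 : 0 < 2 * n.+1%:R :> R by rewrite mulr_gt0.
rewrite W_ffact ler_wpM2l // -ler_pdivrMl ?sqrtr_gt0 //.
set s := (Num.sqrt _)^-1.
have s0 : 0 <= s by rewrite invr_ge0 sqrtr_ge0.
apply: le_trans (gauss_int_le (_ : 0 <= s * n%:R)); last by rewrite mulr_ge0.
apply: le_trans (gauss_sum_le n s0); rewrite ler_wpM2l // big_add1 /=.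
apply: ler_sum_nat => i /andP[i1 iltn]; rewrite gauss_fun_sqrt //.
apply: le_trans (ffact_ratio_le _ iltn) _ => //.
rewrite ler_expR ler_pM2r ?invr_gt0 // lerN2 -(natr1 i).
by have := ler0n R i; nra.
Qed.

(** The sum is cut at m. Starting it at j = 2 loses at most the integral up to 2 s, which is at most
    2 s and yields the constant 2. *)
Lemma W_ge n m (s := (Num.sqrt (2 * (n%:R - m%:R)))^-1) :
  (0 < m)%N -> (m < n)%N ->
  n%:R * (s^-1 * gauss_int (s * m%:R) - 2) <= W R n.
Proof.
move=> m0 mn; rewrite W_ffact ler_wpM2l //.
have x0 : 0 < 2 * (n%:R - m%:R) :> R by rewrite mulr_gt0 // subr_gt0 ltr_nat.
have s0 : 0 < s by rewrite invr_gt0 sqrtr_gt0.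
have -> : s^-1 * gauss_int (s * m%:R) - 2 =
    s^-1 * (gauss_int (s * m%:R) - s * 2) by field; rewrite gt_eqF.
rewrite ler_pdivrMl //.
apply: (@le_trans _ _ (s * \sum_(2 <= j < m.+1) gauss_fun (s * j%:R))).
  apply: le_trans (gauss_sum_ge (ltW s0) _) => //; rewrite lerB //.
    by apply: gauss_int_homo; rewrite ?ler_wpM2l ?mulr_ge0 ?ler_nat // ltW.
  by apply: gauss_int_le_id; rewrite mulr_ge0 // ltW.
rewrite ler_wpM2l ?(ltW s0) // [leRHS](@big_cat_nat _ _ _ m.+1) //=;
  last exact: ltnW.
rewrite -[leLHS]addr0 lerD ?sumr_ge0 // => [|i _]; last exact: ffact_ratio_ge0.
apply: ler_sum_nat => j /andP[_ jm].
by rewrite gauss_fun_sqrt // ffact_ratio_ge.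
Qed.

End GaussSums.

(** * The limit of W_n / n^(3/2) *)

Section Asymptotics.
Variable R : realType.
Implicit Types (x y : R) (n : nat).

Lemma cvgy_sqrt : Num.sqrt x @[x --> +oo] --> (+oo : set_system R).
Proof.
apply/cvgryPge => A; near=> x; apply: le_trans (ler_norm A) _.
rewrite -sqrtr_sqr ler_wsqrtr //; near: x; exact: nbhs_pinfty_ge.
Unshelve. all: by end_near. Qed.

Lemma cvgy_inv : (x : R)^-1 @[x --> +oo] --> (0 : R).
Proof. by apply/gtr0_cvgV0; [exact: nbhs_pinfty_gt|exact: cvg_id]. Qed.

(** The bound of [W_ge], divided by y^6 = n^(3/2) and simplified, for n = y^4 and m = floor
    (y^3). *)
Definition W_lower y : R :=
  Num.sqrt 2 * Num.sqrt (1 - y^-1) * gauss_int ((y - 1) / Num.sqrt 2)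
  - 2 * (y^-1 * y^-1).

Lemma cvg_W_lower : W_lower y @[y --> +oo] --> Num.sqrt 2 * (Num.sqrt pi / 2).
Proof.
have -> : Num.sqrt 2 * (Num.sqrt pi / 2) =
  Num.sqrt 2 * Num.sqrt (1 - 0) * (Num.sqrt pi / 2) - 2 * (0 * 0) :> R.
  by rewrite subr0 sqrtr1; ring.
apply: cvgB; last first.
  by apply: cvgM; [exact: cvg_cst|apply: cvgM; exact (@cvgy_inv)].
apply: cvgM.
  apply: cvgM; first exact: cvg_cst.
  apply: continuous_cvg; first exact: sqrt_continuous.
  by apply: cvgB; [exact: cvg_cst|exact (@cvgy_inv)].
apply: cvg_comp (@cvg_gauss_int R).
apply/cvgryPge => A; near=> y.
rewrite ler_pdivlMr ?sqrtr_gt0 // lerBrDr.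
by near: y; apply: nbhs_pinfty_ge; exact: num_real.
Unshelve. all: by end_near. Qed.

Lemma W_lower_le y n : 1 < y -> n%:R = y ^+ 4 -> W_lower y <= W R n / y ^+ 6.
Proof.
move=> y1 nE; have y0 : 0 < y by lra.
(* A cut of order n^(3/4): small against n, so that n - m ~ n, and large against sqrt n, so that the
   whole Gauss integral is reached. *)
pose m := Num.truncn (y ^+ 3).
have /andP[m_le m_gt] : m%:R <= y ^+ 3 < m.+1%:R.
  by rewrite truncn_itv ?exprn_ge0 ?ltW.
have m0 : (0 < m)%N.
  by rewrite -ltnS -(ltr_nat R) (le_lt_trans _ m_gt) // exprn_ege1 // ltW.
have mn : (m < n)%N.
  rewrite -(ltr_nat R) (le_lt_trans m_le) // nE [ltRHS]exprS.
  by rewrite -ltr_pdivrMr ?exprn_gt0 // divff ?gt_eqF ?exprn_gt0.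
have := W_ge R m0 mn; set d := n%:R - m%:R => Wm.
have d0 : 0 < d by rewrite subr_gt0 ltr_nat.
have s20 : 0 < Num.sqrt 2 :> R by rewrite sqrtr_gt0.
have sd0 : 0 < Num.sqrt d by rewrite sqrtr_gt0.
rewrite ler_pdivlMr ?exprn_gt0 //; apply: le_trans Wm.
have -> : W_lower y * y ^+ 6 = y ^+ 4 * (W_lower y * y ^+ 2) by ring.
rewrite invrK nE sqrtrM //.
rewrite ler_pM2l ?exprn_gt0 // mulrBl lerB //; last first.
  by rewrite (_ : 2 * _ * _ = 2) //; field; rewrite gt_eqF.
have y2 : Num.sqrt (1 - y^-1) * y ^+ 2 <= Num.sqrt d.
  rewrite -[y ^+ 2]ger0_norm ?exprn_ge0 ?(ltW y0) // -sqrtr_sqr -sqrtrM.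
    rewrite ler_wsqrtr // mulrBl mul1r -exprM /d nE lerB //.
    by apply: le_trans m_le _; rewrite exprS mulKf // gt_eqF.
  by rewrite subr_ge0 invf_le1 // ltW.
have yG : gauss_int ((y - 1) / Num.sqrt 2) <=
          gauss_int ((Num.sqrt 2 * Num.sqrt d)^-1 * m%:R).
  apply: gauss_int_homo; first by rewrite divr_ge0 ?subr_ge0 ?ltW.
  rewrite invfM mulrC -mulrA ler_pM2l ?invr_gt0 // mulrC ler_pdivlMr //.
  have sdy : Num.sqrt d <= y ^+ 2.
    rewrite -[y ^+ 2]ger0_norm ?exprn_ge0 ?(ltW y0) // -sqrtr_sqr ler_wsqrtr //.
    by rewrite -exprM -nE gerBl.
  apply: (@le_trans _ _ ((y - 1) * y ^+ 2)).
    by rewrite ler_wpM2l // subr_ge0 ltW.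
  have : 1 <= y ^+ 2 by rewrite exprn_ege1 // ltW.
  by move: m_gt; rewrite -natr1 [y ^+ 3]exprS; lra.
have G0 z : 0 <= gauss_int z :> R.
  exact: gauss_integral_proof.integral0_gauss_ge0.
rewrite -[leRHS]mulrA mulrAC -(mulrA (Num.sqrt 2)) -mulrA ler_pM2l //.
by rewrite ler_pM // mulr_ge0 ?sqrtr_ge0 ?exprn_ge0 ?ltW.
Qed.

Lemma W_le_sqrt y n : 0 < y -> n%:R = y ^+ 4 ->
  W R n / y ^+ 6 <= Num.sqrt 2 * (Num.sqrt pi / 2).
Proof.
move=> y0 nE; rewrite ler_pdivrMr ?exprn_gt0 //; apply: le_trans (W_le R n) _.
have s4 : Num.sqrt (y ^+ 4) = y ^+ 2.
  by rewrite (exprM _ 2 2) sqrtr_sqr ger0_norm // exprn_ge0 // ltW.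
by rewrite nE sqrtrM // s4 le_eqVlt; apply/orP; left; apply/eqP; ring.
Qed.

(** Half-integer powers of n become integer powers of this, which [field] can handle. *)
Definition sqrt_nat n : R := Num.sqrt n%:R.

Lemma cvg_sqrt_nat : sqrt_nat n @[n --> \oo] --> +oo.
Proof. apply: cvg_comp cvgr_idn (@cvgy_sqrt). Qed.

Lemma cvg_W :
  W R n / sqrt_nat n ^+ 3 @[n --> \oo] --> Num.sqrt 2 * (Num.sqrt pi / 2).
Proof.
(* The parameter y is n^(1/4), a double square root. *)
apply: (@squeeze_cvgr _ _ _ _ (W_lower \o Num.sqrt \o sqrt_nat)
         (cst (Num.sqrt 2 * (Num.sqrt pi / 2)))).
- near=> n; have n1 : 1 < n%:R :> R.
    by rewrite ltr1n; near: n; exact: nbhs_infty_gt.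
  have y1 : 1 < Num.sqrt (sqrt_nat n).
    have sqrt_gt1 z : 1 < z -> 1 < Num.sqrt z :> R.
      by move=> z1; rewrite -[ltLHS]sqrtr1 ltr_sqrt // (lt_trans ltr01).
    by apply/sqrt_gt1/sqrt_gt1.
  have E : sqrt_nat n = Num.sqrt (sqrt_nat n) ^+ 2.
    by rewrite sqr_sqrtr ?sqrtr_ge0.
  have nE : n%:R = Num.sqrt (sqrt_nat n) ^+ 4.
    by rewrite (exprM _ 2 2) -E sqr_sqrtr.
  rewrite [X in _ / X ^+ 3]E -exprM /=.
  by rewrite W_lower_le //= W_le_sqrt // (lt_trans ltr01).
- apply: cvg_comp cvg_sqrt_nat _; apply: cvg_comp (@cvgy_sqrt) (@cvg_W_lower).
- exact: cvg_cst.
Unshelve. all: by end_near. Qed.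

End Asymptotics.

(** * Bounds for pi *)

Section PiBounds.
Variable R : realType.
Implicit Types (x y : R) (k : nat).

(** The first k terms of the Taylor series of the arctangent at 0. *)
Definition atan_poly k x := \sum_(i < k) (-1) ^+ i * x ^+ i.*2.+1 / i.*2.+1%:R.

Lemma is_derive_atan_poly k x :
  is_derive x 1 (atan_poly k) ((1 - (- x ^+ 2) ^+ k) / (1 + x ^+ 2)).
Proof.
have x2 : 1 + x ^+ 2 != 0 by rewrite gt_eqF // ltr_pwDl // sqr_ge0.
elim: k => [|k IH].
  rewrite expr0 subrr mul0r.
  rewrite (_ : atan_poly 0 = cst 0); first exact: is_derive_cst.
  by apply/funext => y; rewrite /atan_poly big_ord0.
have -> : atan_poly k.+1 =
    atan_poly k + ((-1) ^+ k / k.*2.+1%:R) *: (id ^+ k.*2.+1).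
  apply/funext => y; rewrite /atan_poly big_ord_recr /= fctE /= mulrAC.
  by rewrite -[in RHS]/(_ * _) exprfctE.
have Dm := is_deriveZ ((-1) ^+ k / k.*2.+1%:R : R)
                      (is_deriveX k.*2.+1 (is_derive_id x (1 : R))).
apply: (is_derive_eq (is_deriveD IH Dm)).
rewrite scaler1 /GRing.scale /=.
rewrite mulrA divfK ?pnatr_eq0 // [in RHS]exprS.
rewrite [(- x ^+ 2) ^+ k]exprNn -exprM mul2n; field.
exact: x2.
Qed.

(** The error has derivative (- z^2)^k / (1 + z^2), of sign (-1)^k, and vanishes at 0; the mean
    value theorem gives its sign. *)
Lemma atan_polyP k x : 0 <= x -> 0 <= (-1) ^+ k * (atan x - atan_poly k x).
Proof.
move=> x0.
have D (z : R) : is_derive z 1 (fun y => atan y - atan_poly k y)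
    ((- z ^+ 2) ^+ k / (1 + z ^+ 2)).
  have := is_derive_atan_poly k z => Dp.
  by apply: is_derive_eq; rewrite mulrBl mul1r opprB addrC subrK.
have [|c] := @MVT_segment R _ _ 0 x x0 (fun z _ => D z).
  apply: derivable_within_continuous => z _.
  by have [] := D z.
rewrite in_itv /= => /andP[c0 _].
have p0 : atan_poly k 0 = 0 :> R.
  by rewrite /atan_poly big1 // => i _; rewrite exprS mul0r mulr0 mul0r.
rewrite atan0 p0 !subr0 => ->.
rewrite [(- c ^+ 2) ^+ k]exprNn !mulrA -exprMn mulrNN mulr1 expr1n mul1r.
by rewrite !mulr_ge0 ?invr_ge0 ?addr_ge0 ?exprn_ge0.
Qed.

(** Machin's formula: 4 a and b + pi/4 both have tangent 120/119 and lie where the tangent is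
    injective. *)
Lemma machin : pi / 4 = 4 * atan 5^-1 - atan 239^-1 :> R.
Proof.
have tan_double (t : R) : - (pi / 2) < t < pi / 2 ->
    tan (t + t) = (tan t + tan t) / (1 - tan t * tan t).
  by move=> /cos_gt0_pihalf/lt0r_neq0 ct; rewrite tanD.
pose a : R := atan 5^-1; pose b : R := atan 239^-1.
have a0 : 0 < a by rewrite -atan0; apply: lt_atan; rewrite invr_gt0 ltr0n.
have b0 : 0 < b by rewrite -atan0; apply: lt_atan; rewrite invr_gt0 ltr0n.
have bpi : b < pi / 4.
  by rewrite -atan1; apply: lt_atan; rewrite invf_lt1 ?ltr1n ?ltr0n.
have pi2 := pi_ge2 R.
(* This keeps 4 a <= 4/5 below pi/2, which is at least 1. *)
have a5 : a <= 5^-1.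
  have := @atan_polyP 1 5^-1; rewrite /atan_poly big_ord1 /= => H.
  have := H ltac:(by rewrite invr_ge0).
  by rewrite -/a double0 expr0 !expr1; lra.
have ta : tan a = 5^-1 by exact: atanK.
have tb : tan b = 239^-1 by exact: atanK.
have tp : tan (pi / 4) = 1 :> R by exact: tan_piquarter.
have ta2 : tan (a + a) = 5 / 12 by rewrite tan_double ?ta; [field|lra].
have ta4 : tan ((a + a) + (a + a)) = 120 / 119.
  by rewrite tan_double ?ta2; [field|lra].
have cb : cos b != 0 by apply/lt0r_neq0/cos_gt0_pihalf; lra.
have cp : cos (pi / 4) != 0 :> R by apply/lt0r_neq0/cos_gt0_pihalf; lra.
have tbp : tan (b + pi / 4) = 120 / 119 by rewrite tanD // tb tp; field.
have : (a + a) + (a + a) = b + pi / 4.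
  by apply: tan_inj; rewrite ?in_itv /= ?ta4 ?tbp //; lra.
by rewrite -/a -/b; lra.
Qed.

(** The difference 6 pi - 75/4 in the skewness is only about 0.1 and magnifies the relative error of
    pi, hence this accuracy for ten digits. *)
Lemma pi_bounds :
  3 + 141 / 10 ^+ 3 + 592 / 10 ^+ 6 + 653 / 10 ^+ 9 + 589 / 10 ^+ 12
    + 7 / 10 ^+ 13 < pi :> R /\
  pi < 3 + 141 / 10 ^+ 3 + 592 / 10 ^+ 6 + 653 / 10 ^+ 9 + 590 / 10 ^+ 12 :> R.
Proof.
have i5 : 0 <= 5^-1 :> R by rewrite invr_ge0.
have i239 : 0 <= 239^-1 :> R by rewrite invr_ge0 ler0n.
have := machin.
have := atan_polyP 9 i5; have := atan_polyP 10 i5.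
have := atan_polyP 3 i239; have := atan_polyP 4 i239.
move: (atan 5^-1) (atan 239^-1) => a b.
rewrite /atan_poly !big_ord_recr !big_ord0 /= !doubleS double0 !exprVn add0r.
by split; lra.
Qed.

End PiBounds.

(** * Limits *)

Section FinalLimits.
Variable R : realType.

Local Notation c := (Num.sqrt 2 * (Num.sqrt pi / 2) : R).

Lemma cvg_exprn (f : nat -> R) (l : R) k :
  f n @[n --> \oo] --> l -> f n ^+ k @[n --> \oo] --> l ^+ k.
Proof.
move=> fl.
exact: (@cvg_comp _ _ _ f (fun x => x ^+ k) _ _ _ fl (@exprn_continuous R k l)).
Qed.

Lemma cvg_inv_sqrt_nat : (sqrt_nat R n)^-1 @[n --> \oo] --> (0 : R).
Proof. apply: cvg_comp (@cvg_sqrt_nat R) (@cvgy_inv R). Qed.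

Lemma cvg_inv_sqrt_natX k : (sqrt_nat R n)^-1 ^+ k.+1 @[n --> \oo] --> (0 : R).
Proof.
rewrite -[X in _ --> X](expr0n R k.+1); apply: cvg_exprn.
exact: @cvg_inv_sqrt_nat.
Qed.

Lemma cvg_scale (a : R) (f : nat -> R) (l : R) :
  f n @[n --> \oo] --> l -> a * f n @[n --> \oo] --> a * l.
Proof. by move=> fl; apply: cvgM => //; exact: cvg_cst. Qed.

Lemma sqrt_nat_gt0 n : (0 < n)%N -> 0 < sqrt_nat R n.
Proof. by move=> n0; rewrite sqrtr_gt0 ltr0n. Qed.

Lemma sqrt_natE n : sqrt_nat R n ^+ 2 = n%:R.
Proof. by rewrite sqr_sqrtr. Qed.

Lemma cvg_third_moment :
  third_moment R n / sqrt_nat R n ^+ 9 @[n --> \oo] -->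
    (2 * c ^+ 3 - 25 / 8 * c : R).
Proof.
pose w n := W R n / sqrt_nat R n ^+ 3; pose u n := (sqrt_nat R n)^-1.
have wc : w n @[n --> \oo] --> c := @cvg_W R.
have pol k : u n ^+ k.+1 @[n --> \oo] --> (0 : R) := @cvg_inv_sqrt_natX k.
(* Each 0 is the limit of a power of u = n^(-1/2). The normalized moment is a polynomial in u and w
   = W_n / n^(3/2), taken term by term. *)
have -> : 2 * c ^+ 3 - 25 / 8 * c =
  2 * c ^+ 3 + 17 / 2 * (c ^+ 2 * 0)
  + (- (25 / 8) + 277 / 24 * 0 - 1 / 60 * 0) * c
  - 151 / 30 * 0 + 76 / 15 * 0 - 1 / 30 * 0 :> R by ring.
apply: (@cvg_trans _ ((fun n => 2 * w n ^+ 3 + 17 / 2 * (w n ^+ 2 * u n ^+ 1)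
  + (- (25 / 8) + 277 / 24 * u n ^+ 2 - 1 / 60 * u n ^+ 4) * w n
  - 151 / 30 * u n ^+ 1 + 76 / 15 * u n ^+ 3 - 1 / 30 * u n ^+ 5) @ \oo)).
  apply: near_eq_cvg; near=> n.
  have n0 : (0 < n)%N by near: n; exact: nbhs_infty_gt.
  rewrite third_momentE // -(sqrt_natE n) /w /u.
  by field; rewrite gt_eqF // sqrt_nat_gt0.
apply: cvgB; last exact/cvg_scale/pol.
apply: cvgD; last exact/cvg_scale/pol.
apply: cvgB; last exact/cvg_scale/pol.
apply: cvgD.
  apply: cvgD; first by apply: cvg_scale; apply: cvg_exprn.
  by apply: cvg_scale; apply: cvgM; [apply: cvg_exprn|exact: pol].
apply: cvgM => //; apply: cvgB; last exact/cvg_scale/pol.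
by apply: cvgD; [exact: cvg_cst|exact/cvg_scale/pol].
Unshelve. all: by end_near. Qed.

Lemma cvg_variance :
  variance_X R n / sqrt_nat R n ^+ 6 @[n --> \oo] --> (5 / 3 - c ^+ 2 : R).
Proof.
pose w n := W R n / sqrt_nat R n ^+ 3; pose u n := (sqrt_nat R n)^-1.
have wc : w n @[n --> \oo] --> c := @cvg_W R.
have pol k : u n ^+ k.+1 @[n --> \oo] --> (0 : R) := @cvg_inv_sqrt_natX k.
have -> : 5 / 3 - c ^+ 2 =
  5 / 3 - 5 / 3 * 0 - 17 / 6 * (0 * c) - c ^+ 2 :> R by ring.
apply: (@cvg_trans _ ((fun n => 5 / 3 - 5 / 3 * u n ^+ 2
  - 17 / 6 * (u n ^+ 1 * w n) - w n ^+ 2) @ \oo)).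
  apply: near_eq_cvg; near=> n.
  have n0 : (0 < n)%N by near: n; exact: nbhs_infty_gt.
  rewrite variance_XE // -(sqrt_natE n) /w /u.
  by field; rewrite gt_eqF // sqrt_nat_gt0.
apply: cvgB; last exact: cvg_exprn.
apply: cvgB; last by apply: cvg_scale; apply: cvgM; [exact: pol|].
by apply: cvgB; [exact: cvg_cst|exact/cvg_scale/pol].
Unshelve. all: by end_near. Qed.

(** Makes the limit (10 - 3 pi) / 6 of the normalized variance positive. *)
Lemma pi_lt_10_3 : pi < 10 / 3 :> R.
Proof. by have [_] := pi_bounds R; lra. Qed.

Lemma W_const_sqr : c ^+ 2 = pi / 2 :> R.
Proof. by rewrite !exprMn exprVn !sqr_sqrtr ?pi_ge0 //; field. Qed.

Lemma powR_9_2_nat n : n%:R `^ (9 / 2) = sqrt_nat R n ^+ 9.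
Proof.
have -> : 9 / 2 = 2^-1 * 9%:R :> R by rewrite mulrC.
by rewrite powRrM powR12_sqrt // powR_mulrn ?sqrtr_ge0.
Qed.

Lemma powR_3_2 (a : R) : 0 <= a -> a `^ (3 / 2) = Num.sqrt a ^+ 3.
Proof.
move=> a0; have -> : 3 / 2 = 2^-1 * 3%:R :> R by rewrite mulrC.
by rewrite powRrM powR12_sqrt // powR_mulrn ?sqrtr_ge0.
Qed.

Lemma third_constE :
  1 / 2 * Num.sqrt 2 * pi `^ (3 / 2) - 25 / 16 * Num.sqrt 2 * Num.sqrt pi
  = 2 * c ^+ 3 - 25 / 8 * c :> R.
Proof.
rewrite powR_3_2 ?pi_ge0 //.
have s2 : Num.sqrt 2 ^+ 2 = 2 :> R by rewrite sqr_sqrtr.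
have -> : 2 * c ^+ 3 = Num.sqrt 2 ^+ 2 * Num.sqrt 2 * Num.sqrt pi ^+ 3 / 4.
  by field.
by rewrite s2; field.
Qed.

(** By c^2 = pi/2 this amounts to pi > 25/8. The quotient of asymptotically equal terms needs the
    constant to be nonzero. *)
Lemma third_const_gt0 : 0 < 2 * c ^+ 3 - 25 / 8 * c :> R.
Proof.
have -> : 2 * c ^+ 3 - 25 / 8 * c = c * (2 * c ^+ 2 - 25 / 8) :> R by ring.
have c0 : 0 < c :> R by rewrite mulr_gt0 ?divr_gt0 ?sqrtr_gt0 ?pi_gt0.
rewrite mulr_gt0 // W_const_sqr; have [] := pi_bounds R; lra.
Qed.

Lemma cvg_third_ratio :
  third_moment R n / ((1 / 2 * Num.sqrt 2 * pi `^ (3 / 2)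
    - 25 / 16 * Num.sqrt 2 * Num.sqrt pi) * n%:R `^ (9 / 2))
    @[n --> \oo] --> (1 : R).
Proof.
rewrite third_constE; set K : R := 2 * c ^+ 3 - 25 / 8 * c.
have K0 : K != 0 by rewrite gt_eqF // third_const_gt0.
have E : (fun n => third_moment R n / (K * n%:R `^ (9 / 2))) =
    (fun n => third_moment R n / sqrt_nat R n ^+ 9 * K^-1).
  by apply/funext => n; rewrite powR_9_2_nat invfM mulrCA mulrC.
by rewrite E -(divff K0); apply: cvgM; [exact: cvg_third_moment|exact: cvg_cst].
Qed.

Lemma skewness_limitE (q := 10 - 3 * pi) :
  (2 * c ^+ 3 - 25 / 8 * c) / Num.sqrt (5 / 3 - c ^+ 2) ^+ 3 =
  (6 * pi - 75 / 4) * Num.sqrt 3 * Num.sqrt (pi / q) / q :> R.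
Proof.
have q0 : 0 < q by have := pi_lt_10_3; rewrite /q; lra.
have p0 := pi_gt0 R.
have s2 : 0 < Num.sqrt 2 :> R by rewrite sqrtr_gt0.
have s3 : 0 < Num.sqrt 3 :> R by rewrite sqrtr_gt0.
have sq : 0 < Num.sqrt q by rewrite sqrtr_gt0.
have e2 : Num.sqrt 2 ^+ 2 = 2 :> R by rewrite sqr_sqrtr.
have e3 : Num.sqrt 3 ^+ 2 = 3 :> R by rewrite sqr_sqrtr.
have eq : Num.sqrt q ^+ 2 = q by rewrite sqr_sqrtr // ltW.
have -> : 5 / 3 - c ^+ 2 = q / (2 * 3) by rewrite W_const_sqr /q; field.
have -> : 2 * c ^+ 3 - 25 / 8 * c = c * (2 * c ^+ 2 - 25 / 8) :> R by ring.
rewrite W_const_sqr !sqrtrM ?sqrtrV ?mulr_ge0 ?ltW // sqrtrM //.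
rewrite -[X in _ = _ / X]eq; move: (Num.sqrt q) sq => t t0.
have -> : (t / (Num.sqrt 2 * Num.sqrt 3)) ^+ 3 =
  t ^+ 3 / (Num.sqrt 2 ^+ 2 * Num.sqrt 2 * (Num.sqrt 3 ^+ 2 * Num.sqrt 3)) :> R.
  by field; rewrite !gt_eqF.
rewrite e2 e3.
transitivity (Num.sqrt 2 ^+ 2 * (3 * Num.sqrt 3 * Num.sqrt pi * (pi - 25 / 8))
              / t ^+ 3); first by field; rewrite !gt_eqF.
by rewrite e2; field; rewrite !gt_eqF.
Qed.

Lemma cvg_skewness : skewness R n @[n --> \oo] -->
  ((6 * pi - 75 / 4) * Num.sqrt 3 * Num.sqrt (pi / (10 - 3 * pi))
     / (10 - 3 * pi) : R).
Proof.
rewrite -skewness_limitE; set V : R := 5 / 3 - c ^+ 2.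
have V0 : 0 < V.
  by rewrite /V W_const_sqr; have := pi_lt_10_3; lra.
apply: (@cvg_trans _ ((fun n => third_moment R n / sqrt_nat R n ^+ 9 /
   Num.sqrt (variance_X R n / sqrt_nat R n ^+ 6) ^+ 3) @ \oo)).
  apply: near_eq_cvg; near=> n.
  have n0 : (0 < n)%N by near: n; exact: nbhs_infty_gt.
  have r0 := sqrt_nat_gt0 n0.
  (* Positive for large n because its normalized limit V is; the square root then distributes over
     the quotient. *)
  have v0 : 0 < variance_X R n.
    have : 0 < variance_X R n / sqrt_nat R n ^+ 6.
      by near: n; apply: (cvgr_gt _ cvg_variance).
    by rewrite pmulr_lgt0 // invr_gt0 exprn_gt0.
  rewrite /skewness powR_3_2 ?ltW // sqrtrM ?ltW // sqrtrV ?exprn_ge0 ?ltW //.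
  rewrite (exprM _ 3 2) sqrtr_sqr ger0_norm ?exprn_ge0 ?ltW //.
  by field; rewrite !gt_eqF // sqrtr_gt0.
apply: cvgM; first exact: cvg_third_moment.
apply: cvgV; first by rewrite expf_neq0 // gt_eqF // sqrtr_gt0.
apply: cvg_exprn.
exact: (@cvg_comp _ _ _ _ (@Num.sqrt R) _ _ _
          cvg_variance (@sqrt_continuous R V)).
Unshelve. all: by end_near. Qed.

(* p1 < pi < p2 and the square of the limit is increasing in pi, which reduces
   the digits to an inequality between rational numbers. *)
Lemma skewness_digits (q := 10 - 3 * pi : R)
    (x := (6 * pi - 75 / 4) * Num.sqrt 3 * Num.sqrt (pi / q) / q) :
  decimal_digits x [:: 7; 0; 0; 5; 6; 6; 5; 2; 9; 3]%N.
Proof.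
have [lo hi] := pi_bounds R.
pose p1 : R := 3 + 141 / 10 ^+ 3 + 592 / 10 ^+ 6 + 653 / 10 ^+ 9
               + 589 / 10 ^+ 12 + 7 / 10 ^+ 13.
pose p2 : R := 3 + 141 / 10 ^+ 3 + 592 / 10 ^+ 6 + 653 / 10 ^+ 9
               + 590 / 10 ^+ 12.
rewrite -/p1 in lo; rewrite -/p2 in hi.
rewrite /decimal_digits !big_ord_recr big_ord0 /=.
set a : R := (X in X <= _).
have q0 : 0 < q by have := pi_lt_10_3; rewrite /q; lra.
have u0 : 0 < 6 * p1 - 75 / 4 by rewrite /p1; lra.
(* Squaring is monotone only for nonnegative bases, so the signs at p1 and pi are needed. *)
have u1 : 0 < 6 * pi - 75 / 4 :> R by lra.
have p10 : 0 < p1 by rewrite /p1; lra.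
have x0 : 0 <= x.
  by rewrite divr_ge0 ?mulr_ge0 ?sqrtr_ge0 ?ltW.
have x2 : x ^+ 2 = 3 * pi * (6 * pi - 75 / 4) ^+ 2 / q ^+ 3.
  rewrite /x !exprMn exprVn !sqr_sqrtr //; last first.
    by rewrite divr_ge0 ?pi_ge0 // ltW.
  by field; rewrite gt_eqF.
have q20 : 0 < 10 - 3 * p2 by rewrite /p2; lra.
have num_le (s t : R) : 0 < s -> 0 < 6 * s - 75 / 4 -> s <= t ->
    3 * s * (6 * s - 75 / 4) ^+ 2 <= 3 * t * (6 * t - 75 / 4) ^+ 2.
  move=> s0 us st; apply: ler_pM; [by lra|by rewrite sqr_ge0|by lra|].
  by rewrite lerXn2r ?nnegrE //; lra.
have den_le (s t : R) : s <= t -> 0 < 10 - 3 * t ->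
    (10 - 3 * t) ^+ 3 <= (10 - 3 * s) ^+ 3.
  by move=> st t0; rewrite lerXn2r ?nnegrE //; lra.
apply/andP; split.
  have a0 : 0 <= a by rewrite /a; lra.
  rewrite -(@ler_pXn2r _ 2) ?nnegrE // x2 ler_pdivlMr ?exprn_gt0 //.
  apply: le_trans (num_le _ _ p10 u0 (ltW lo)).
  apply: (@le_trans _ _ (a ^+ 2 * (10 - 3 * p1) ^+ 3)).
    by rewrite ler_wpM2l ?exprn_ge0 // den_le // ltW.
  by rewrite /a /p1; lra.
have b0 : 0 <= a + 10 ^- 10 by rewrite /a; lra.
rewrite -(@ltr_pXn2r _ 2) ?nnegrE // x2 ltr_pdivrMr ?exprn_gt0 //.
apply: le_lt_trans (num_le _ _ (pi_gt0 R) u1 (ltW hi)) _.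
apply: (@lt_le_trans _ _ ((a + 10 ^- 10) ^+ 2 * (10 - 3 * p2) ^+ 3));
  last first.
  by rewrite ler_wpM2l ?exprn_ge0 // den_le // ltW.
by rewrite /a /p2; lra.
Qed.

End FinalLimits.

Unset Implicit Arguments.

Theorem theorem3 (R : realType) :
  [/\ forall n : nat, (0 < n)%N ->
        third_moment R n =
          2 * W R n ^+ 3 + 17 / 2 * n%:R * W R n ^+ 2
          + (- (25 / 8) * n%:R ^+ 3 + 277 / 24 * n%:R ^+ 2 - 1 / 60 * n%:R)
              * W R n
          - 151 / 30 * n%:R ^+ 4 + 76 / 15 * n%:R ^+ 3 - 1 / 30 * n%:R ^+ 2,
      (fun n : nat =>
         third_moment R n /
         ((1 / 2 * Num.sqrt 2 * pi `^ (3 / 2)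
           - 25 / 16 * Num.sqrt 2 * Num.sqrt pi) * n%:R `^ (9 / 2)))
        @ \oo --> (1 : R),
      (fun n : nat => skewness R n) @ \oo -->
        ((6 * pi - 75 / 4) * Num.sqrt 3 * Num.sqrt (pi / (10 - 3 * pi))
           / (10 - 3 * pi) : R)
    & decimal_digits
        ((6 * pi - 75 / 4) * Num.sqrt 3 * Num.sqrt (pi / (10 - 3 * pi))
           / (10 - 3 * pi) : R)
        [:: 7; 0; 0; 5; 6; 6; 5; 2; 9; 3]%N ].
Proof.
split.
- exact: third_momentE.
- exact: cvg_third_ratio.
- exact: cvg_skewness.
(* The expansion proved is 0.7005665293..., which agrees with 0.7005665208... in the first eight
   decimals only. *)
- exact: skewness_digits.
Qed.
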